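(* Let $V$ be a vector space over a field $\mathbb F$, of dimension at most $\aleph_0$, let $\mathcal L$ be a series in $V$, let $S(\mathcal L)$ be the stability group of $\mathcal L$, and let $H(\mathcal L)$ be the Hirsch-Plotkin radical of $S(\mathcal L)$. Then $$H(\mathcal L)=\{g\in S(\mathcal L)\mid g \text{ stabilizes a finite subseries of } \mathcal L\}.$$ Moreover $H(\mathcal L)$ is a Fitting group.
   Context: A series in an $\mathbb F$-vector space $V$ is a set $\mathcal L$ of subspaces of $V$, linearly ordered by inclusion, containing $0$ and $V$, such that for every $\mathcal F\subseteq\mathcal L$ both $\bigcap_{W\in\mathcal F}W$ and $\bigcup_{W\in\mathcal F}W$ belong to $\mathcal L$ (with the convention that the empty intersection is $V$ and the empty union is $0$). A subseries of $\mathcal L$ is a subset of $\mathcal L$ which is itself a series in $V$; in particular every finite subset of $\mathcal L$ containing $0$ and $V$ is a subseries. A jump of $\mathcal L$ is a pair $(B,T)$ of elements of $\mathcal L$ with $B<T$ and no element of $\mathcal L$ strictly between $B$ and $T$. Linear maps act on the right, and for $g\in \mathrm{GL}(V,\mathbb F)$ and a subspace $T$, $[T,g]=T(g-1)$. The stability group of $\mathcal L$ is $S(\mathcal L)=\{g\in \mathrm{GL}(V,\mathbb F)\mid [T,g]\le B \text{ for every jump }(B,T)\text{ of }\mathcal L\}$. An element $g$ stabilizes a series $\mathcal L'$ if $g\in S(\mathcal L')$. The Hirsch-Plotkin radical of a group is the subgroup generated by all its locally nilpotent normal subgroups. A Fitting group is a group that is generated by its nilpotent normal subgroups; equivalently,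 the normal closure of every element is nilpotent. *)

(* Defs.v *)
From HB Require Import structures.
From mathcomp Require Import all_boot all_order all_algebra.
From mathcomp Require Import all_classical.

Set Implicit Arguments.
Unset Strict Implicit.
Unset Printing Implicit Defensive.

Import GRing.Theory.
Local Open Scope classical_set_scope.
Local Open Scope ring_scope.

(* Groups may be infinite: subgroups of [G : groupType] are sets
   [H : set G] with [subgroup H]; notions "of a group" are stated for such
   sets, so that they apply to subgroups of GL(V, F). *)
Section Groups.
Local Open Scope group_scope.
Variable G : groupType.
Implicit Types (H N X : set G) (g : G).

Definition subgroup H : Prop := group_closed [in H].

Definition generated X : set G := smallest subgroup X.

Definition normal_subgroup N H : Prop :=
  [/\ subgroup N, N `<=` H & forall n h, N n -> H h -> N (n ^ h)].

Fixpoint lower_central H (n : nat) : set G :=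
  if n is k.+1 then
    generated [set c | exists x y, [/\ lower_central H k x, H y & c = [~ x, y]]]
  else H.

Definition nilpotent_group H : Prop :=
  subgroup H /\ exists n, lower_central H n = [set 1].

Definition locally_nilpotent H : Prop :=
  subgroup H /\
  forall X, finite_set X -> X `<=` H -> nilpotent_group (generated X).

Definition hirsch_plotkin H : set G :=
  generated
    (\bigcup_(N in [set N | normal_subgroup N H /\ locally_nilpotent N]) N).

Definition fitting_group H : Prop :=
  subgroup H /\
  generated
    (\bigcup_(N in [set N | normal_subgroup N H /\ nilpotent_group N]) N) = H.

End Groups.

Section GL.
Variables (F : fieldType) (V : lmodType F).

Record gl : Type := GL {
  gl_fun :> V -> V;
  gl_linear : linear gl_fun;
  gl_bij : bijective gl_fun }.

HB.instance Definition _ := gen_eqMixin gl.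
HB.instance Definition _ := gen_choiceMixin gl.
HB.instance Definition _ (g : gl) :=
  GRing.isLinear.Build F V V *:%R (gl_fun g) (gl_linear g).

Lemma gl_eqP (g h : gl) : gl_fun g =1 gl_fun h -> g = h.
Proof.
case: g h => [f fl fb] [f' fl' fb'] /= /funext ff'; move: fl fb.
by rewrite ff' => fl fb; congr GL; exact: Prop_irrelevance.
Qed.

Definition gl_one : gl.
Proof. by exists idfun => //; exists idfun. Defined.

(* Maps act on the right: v (g * h) = (v g) h. *)
Definition gl_mul (g h : gl) : gl.
Proof.
exists (fun v => h (g v)); first by move=> a u v; rewrite !linearP.
exact: (bij_comp (gl_bij h) (gl_bij g)).
Defined.

Lemma gl_inv_subproof (g : gl) :
  exists h : V -> V, cancel g h /\ cancel h g.
Proof. by case: (gl_bij g) => h gK hK; exists h. Qed.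

Definition gl_inv_fun (g : gl) : V -> V := projT1 (cid (gl_inv_subproof g)).

Lemma gl_funK (g : gl) : cancel g (gl_inv_fun g).
Proof. by rewrite /gl_inv_fun; case: cid => h []. Qed.

Lemma gl_inv_funK (g : gl) : cancel (gl_inv_fun g) g.
Proof. by rewrite /gl_inv_fun; case: cid => h []. Qed.

Definition gl_inv (g : gl) : gl.
Proof.
exists (gl_inv_fun g).
  move=> a u v; apply: (can_inj (gl_funK g)).
  by rewrite gl_linear !gl_inv_funK.
by exists g; [exact: gl_inv_funK | exact: gl_funK].
Defined.

Lemma gl_mulA : associative gl_mul.
Proof. by move=> g h k; exact: gl_eqP. Qed.

Lemma gl_mul1 : left_id gl_one gl_mul.
Proof. by move=> g; exact: gl_eqP. Qed.

Lemma gl_mulr1 : right_id gl_one gl_mul.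
Proof. by move=> g; exact: gl_eqP. Qed.

Lemma gl_mulV : left_inverse gl_one gl_inv gl_mul.
Proof. by move=> g; apply: gl_eqP => v; exact: gl_inv_funK. Qed.

Lemma gl_mulrV : right_inverse gl_one gl_inv gl_mul.
Proof. by move=> g; apply: gl_eqP => v; exact: gl_funK. Qed.

HB.instance Definition _ :=
  isGroup.Build gl gl_mulA gl_mul1 gl_mulr1 gl_mulV gl_mulrV.

End GL.
Arguments gl {F} V.

Section Series.
Variables (F : fieldType) (V : lmodType F).
Implicit Types (L M : set (set V)) (B T W : set V) (g : gl V).

Definition is_subspace W : Prop := submod_closed [in W].

Definition linearly_independent B : Prop :=
  forall (s : seq V) (a : V -> F), uniq s -> {subset s <= B} ->
    \sum_(v <- s) a v *: v = 0 -> {in s, forall v, a v = 0}.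

Definition is_basis B : Prop :=
  linearly_independent B /\ smallest is_subspace B = setT.

Definition countable_dim : Prop := exists2 B, is_basis B & countable B.

(* The conventions for the empty family give [setT] (as [\bigcap] over [set0])
   and [[set 0]] (whereas [\bigcup] over [set0] is [set0], hence the
   nonemptiness condition). *)
Definition subspace_series L : Prop :=
  [/\ L `<=` is_subspace,
      forall W W', L W -> L W' -> W `<=` W' \/ W' `<=` W,
      L [set 0] /\ L setT,
      forall FF, FF `<=` L -> L (\bigcap_(W in FF) W)
    & forall FF, FF `<=` L -> FF !=set0 -> L (\bigcup_(W in FF) W)].

Definition subseries M L : Prop := M `<=` L /\ subspace_series M.

Definition jump L B T : Prop :=
  [/\ L B, L T, B `<` T & ~ exists W, [/\ L W, B `<` W & W `<` T]].

(* [commutator_space T g] is [T, g] = T (g - 1). *)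
Definition commutator_space T g : set V := [set g v - v | v in T].

Definition stability_group L : set (gl V) :=
  [set g | forall B T, jump L B T -> commutator_space T g `<=` B].

End Series.
Arguments countable_dim {F} V.

(* Main.v *)
Require Import Defs.
From HB Require Import structures.
From mathcomp Require Import all_boot all_order all_algebra.
From mathcomp Require Import all_classical.
Set Implicit Arguments.
Unset Strict Implicit.
Unset Printing Implicit Defensive.
Import GRing.Theory.
Local Open Scope classical_set_scope.

(** Write [x = g - 1]. The elements stabilizing some finite subseries form a
    subgroup [finite_stabilizer L]: finite subseries have common finite
    refinements. For a finite subseries [M] the stability group of [M] is a
    nilpotent normal subgroup of that of [L] ([stability_group_nilpotent],
    [stability_group_normal]), so [finite_stabilizer L] is generated by
    nilpotent normal subgroups and lies in the Hirsch-Plotkin radical.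

    For the converse it suffices that every locally nilpotent normal subgroup
    [N] of the stability group consists of elements of [finite_stabilizer L]
    ([locally_nilpotent_finite_stabilizer]). An element [a] of [N] is a left
    Engel element: for each [h] some iterated commutator [[h, a, ..., a]] is
    trivial. Let [X] be a proper nonzero member of [L]. The elements acting
    trivially on [X] and modulo [X] form an abelian normal subgroup, on which
    commuting with [a] becomes the bracket [f |-> b f - f b] with [b = a - 1].
    Taking for [f] a map of rank one yields two finiteness properties: every
    vector of [X] is killed by a power of [b] ([engel_vector]), and every
    functional killing [X] is killed by composition with a power of [b]
    ([engel_functional]).

    Given [g] in [N], let [U 0 = 0] and let [U k.+1] be the largest member of
    [L] that [x] sends into [U k]. If [U n] is the whole space for some [n], then
    [U 0], ..., [U n] is a finite subseries stabilized by [g]. Otherwise the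
    sequence either becomes constant below the whole space or ascends for
    ever. In both cases one finds vectors [v j], pairwise far apart in the
    series, with [x (v j)] still not negligible, and functionals [phi j] such
    that [phi j (v j) = 0] and [phi j (x (v j)) = 1]. An infinite, locally
    finite sum of transvections linking each [x (v j)] to the next [v] defines
    [h] in the stability group, and along the chain [v, x v, v', x v', ...] the
    element [g * g ^ h] of [N] has orbits ([growth]) that violate one of the two
    finiteness properties. *)

(** * Groups given as sets *)

Section AbstractGroups.
Local Open Scope group_scope.
Variable G : groupType.
Implicit Types (H N X : set G) (g h : G).

Lemma subgroup1 H : subgroup H -> H 1.
Proof. by case=> /set_mem. Qed.

Lemma subgroupV H g : subgroup H -> H g -> H g^-1.
Proof.
by move=> sH Hg; apply/set_mem/(group_closedV sH); rewrite inE.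
Qed.

Lemma subgroupM H g h : subgroup H -> H g -> H h -> H (g * h).
Proof.
move=> sH Hg Hh; have MH := group_closedM sH.
by apply/set_mem/MH; apply/mem_set.
Qed.

Lemma subgroupP H :
  H 1 -> (forall g h, H g -> H h -> H (g * h)) -> (forall g, H g -> H g^-1) ->
  subgroup H.
Proof.
move=> H1 HM HV; split=> [|g h]; first exact/mem_set.
by move=> /set_mem Hg /set_mem Hh; apply/mem_set/HM => //; apply: HV.
Qed.

Lemma generated_subgroup X : subgroup (generated X).
Proof.
apply: subgroupP => [K [sK _]|g h Xg Xh K KX|g Xg K KX].
- exact: subgroup1.
- by apply: subgroupM (Xg K KX) (Xh K KX); case: KX.
- by apply: subgroupV (Xg K KX); case: KX.
Qed.

Lemma sub_generated X : X `<=` generated X.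
Proof. exact: sub_gen_smallest. Qed.

Lemma generated_min X H : subgroup H -> X `<=` H -> generated X `<=` H.
Proof. exact: smallest_sub. Qed.

Lemma lower_central1 H n : subgroup H -> lower_central H n 1.
Proof.
move=> sH; case: n => [|n] /=; first exact: subgroup1.
exact: (subgroup1 (generated_subgroup _)).
Qed.

Lemma lower_centralS H N n :
  N `<=` H -> lower_central N n `<=` lower_central H n.
Proof.
move=> NH; elim: n => [//|n IHn] /=; apply: generated_min.
  exact: generated_subgroup.
move=> _ [x [y [Nx Ny ->]]]; apply: sub_generated.
by exists x, y; split; [exact: IHn | exact: NH |].
Qed.

Lemma nilpotent_groupS H N :
  subgroup N -> N `<=` H -> nilpotent_group H -> nilpotent_group N.
Proof.
move=> sN NH [_ [n Hn]]; split=> //; exists n; apply/seteqP; split=> [g Ng|_ ->].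
  by rewrite -Hn; apply: lower_centralS Ng.
exact: lower_central1.
Qed.

Lemma nilpotent_locally_nilpotent H :
  nilpotent_group H -> locally_nilpotent H.
Proof.
move=> nilH; have sH := nilH.1; split=> // X _ XH.
by apply: nilpotent_groupS nilH; [exact: generated_subgroup|exact: generated_min].
Qed.

(** The commutators of [h] with [a] start inside the normal subgroup, so they
    live in the nilpotent group generated by [a] and [[~ h, a]]. *)
Lemma locally_nilpotent_engel H N h a :
  normal_subgroup N H -> locally_nilpotent N -> H h -> N a ->
  exists n, iter n (fun c => [~ c, a]) h = 1.
Proof.
move=> [sN NH nN] [_ lnN] Hh Na.
pose X : set G := [set a; [~ h, a]].
have Nha : N [~ h, a].
  by rewrite commgEr; apply: subgroupM => //; apply: nN => //; apply: subgroupV.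
have [] := lnN X; first exact: finite_set2.
  by move=> _ [] ->.
move=> sX [n Xn]; exists n.+1.
suff: lower_central (generated X) n (iter n.+1 (fun c => [~ c, a]) h).
  by rewrite Xn.
elim: {Xn} n => [|n IHn]; first by apply: sub_generated; right.
rewrite iterS; apply: sub_generated.
by exists (iter n.+1 (fun c => [~ c, a]) h), a; split => //; apply: sub_generated; left.
Qed.

End AbstractGroups.

(** * Subspaces, linear functionals and locally finite sums *)

Section LinearAlgebra.
Local Open Scope ring_scope.
Variables (F : fieldType) (V : lmodType F).
Implicit Types (W K D E : set V) (u v w : V).

Lemma subspace0 W : is_subspace W -> W 0.
Proof. by case=> /set_mem. Qed.

Lemma subspaceZD W c u v : is_subspace W -> W u -> W v -> W (c *: u + v).
Proof.
by case=> _ linW Wu Wv; apply/set_mem/linW; apply/mem_set.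
Qed.

Lemma subspaceD W u v : is_subspace W -> W u -> W v -> W (u + v).
Proof. by move=> sW Wu Wv; rewrite -[u]scale1r; apply: subspaceZD. Qed.

Lemma subspaceZ W c u : is_subspace W -> W u -> W (c *: u).
Proof.
by move=> sW Wu; rewrite -[_ *: _]addr0; apply: subspaceZD => //; apply: subspace0.
Qed.

Lemma subspaceN W u : is_subspace W -> W u -> W (- u).
Proof. by move=> sW Wu; rewrite -scaleN1r; apply: subspaceZ. Qed.

Lemma subspaceB W u v : is_subspace W -> W u -> W v -> W (u - v).
Proof. by move=> sW Wu Wv; apply: subspaceD => //; apply: subspaceN. Qed.

Lemma subspaceZr W c u : is_subspace W -> c != 0 -> W (c *: u) -> W u.
Proof.
by move=> sW c0 Wcu; rewrite -(scalerK c0 u); apply: subspaceZ.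
Qed.

Lemma subspaceBr W u v : is_subspace W -> W u -> W (u - v) -> W v.
Proof. by move=> sW Wu Wuv; rewrite -(subKr u v); apply: subspaceB. Qed.

Lemma subspaceDr W u v : is_subspace W -> W v -> W (u + v) -> W u.
Proof. by move=> sW Wv Wuv; rewrite -(addrK v u); apply: subspaceB. Qed.

Lemma subspace_sum W (I : finType) (P : pred I) (f : I -> V) :
  is_subspace W -> (forall i, P i -> W (f i)) -> W (\sum_(i | P i) f i).
Proof.
move=> sW Wf; elim/big_ind: _ => [|u v|//]; first exact: subspace0.
exact: subspaceD.
Qed.

Lemma subspaceP W :
  W 0 -> (forall c u v, W u -> W v -> W (c *: u + v)) -> is_subspace W.
Proof.
move=> W0 WZD; split=> [|c u v]; first exact/mem_set.
by move=> /set_mem Wu /set_mem Wv; apply/mem_set/WZD.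
Qed.

Lemma subspace_set0 : is_subspace [set 0 : V].
Proof. by apply: subspaceP => [//|c u v -> ->] /=; rewrite scaler0 addr0. Qed.

Lemma subspace_add_line W e :
  is_subspace W -> is_subspace [set u | exists c, W (u - c *: e)].
Proof.
move=> sW; apply: subspaceP => [|c u w [cu Wu] [cw Ww]].
  by exists 0; rewrite scale0r subr0; apply: subspace0.
exists (c * cu + cw); rewrite scalerDl -scalerA opprD addrACA -scalerBr.
exact: subspaceZD.
Qed.

Lemma scalar_of (f : V -> F) :
  (forall c u v, f (c *: u + v) = c * f u + f v) ->
  exists phi : {scalar V}, phi =1 f.
Proof.
move=> flin; have lin : scalar f by [].
by exists (HB.pack_for {scalar V} f (GRing.isLinear.Build F V F *%R f lin)).
Qed.

Lemma linear_of (f : V -> V) :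
  (forall c u v, f (c *: u + v) = c *: f u + f v) ->
  exists y : {linear V -> V}, y =1 f.
Proof.
move=> flin; have lin : linear f by [].
by exists (HB.pack_for {linear V -> V} f (GRing.isLinear.Build F V V *:%R f lin)).
Qed.

(** A subspace containing [D0] and maximal among those meeting [W] trivially is
    a complement of [W]. *)
Lemma complement W D0 : is_subspace W -> is_subspace D0 ->
  (forall v, W v -> D0 v -> v = 0) ->
  exists D, [/\ is_subspace D, D0 `<=` D, forall v, W v -> D v -> v = 0
    & forall v, exists2 w, W w & D (v - w)].
Proof.
move=> sW sD0 WD0.
pose P : set (set V) :=
  [set A | A = set0 \/ [/\ is_subspace A, D0 `<=` A & forall v, W v -> A v -> v = 0]].
have [C CP tot|D [PD maxD]] := Zorn_bigcup (P := P).
  have [[A0 CA0 nA0]|noA] := pselect (exists2 A0, C A0 & A0 <> set0); last first.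
    left; rewrite -subset0 => v [A1 CA1 A1v]; apply: noA; exists A1 => // A10.
    by rewrite A10 in A1v.
  have sub A1 : C A1 -> A1 <> set0 ->
      [/\ is_subspace A1, D0 `<=` A1 & forall v, W v -> A1 v -> v = 0].
    by move=> CA1 nA1; have [//|] := CP _ CA1.
  have nz (A1 : set V) v : A1 v -> A1 <> set0 by move=> /[swap] ->.
  right; split=> [|v D0v|v Wv [A1 CA1 A1v]].
  - apply: subspaceP => [|c u v [A1 CA1 A1u] [A2 CA2 A2v]].
      by exists A0 => //; have [/subspace0] := sub _ CA0 nA0.
    have [sA1 _ _] := sub _ CA1 (nz _ _ A1u).
    have [sA2 _ _] := sub _ CA2 (nz _ _ A2v).
    have [A12|A21] := tot _ _ CA1 CA2.
      by exists A2 => //; apply: subspaceZD => //; apply: A12.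
    by exists A1 => //; apply: subspaceZD => //; apply: A21.
  - by exists A0 => //; have [_ + _] := sub _ CA0 nA0; apply.
  - by have [_ _] := sub _ CA1 (nz _ _ A1v); apply.
have [sD D0D WD] : [/\ is_subspace D, D0 `<=` D & forall v, W v -> D v -> v = 0].
  case: PD => // D_0; exfalso; apply: (maxD D0); last by right; split.
  by rewrite D_0; split=> [//|/(_ 0 (subspace0 sD0))].
exists D; split=> // v; apply: contrapT => nv.
pose D' : set V := [set u | exists c, D (u - c *: v)].
apply: (maxD D').
  split=> [u Du|/(_ v)]; first by exists 0; rewrite scale0r subr0.
  have D'v : D' v by exists 1; rewrite scale1r subrr; apply: subspace0.
  move=> /(_ D'v) Dv; apply: nv; exists 0; first exact: subspace0.
  by rewrite subr0.
right; split.
- exact: subspace_add_line.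
- by move=> u /D0D Du; exists 0; rewrite scale0r subr0.
move=> w Ww [c Dw]; have [c0|c0] := eqVneq c 0.
  by apply: WD => //; move: Dw; rewrite c0 scale0r subr0.
exfalso; apply: nv; exists (c^-1 *: w); first exact: subspaceZ.
have -> : v - c^-1 *: w = - (c^-1 *: (w - c *: v)).
  by rewrite scalerBr scalerA mulVf // scale1r opprB.
by apply: subspaceN => //; apply: subspaceZ.
Qed.

Lemma separation K t : is_subspace K -> ~ K t ->
  exists phi : {scalar V}, (forall v, K v -> phi v = 0) /\ phi t = 1.
Proof.
move=> sK nKt; pose W : set V := [set c *: t | c in [set: F]].
have sW : is_subspace W.
  apply: subspaceP => [|c _ _ [a _ <-] [b _ <-]]; first by exists 0; rewrite ?scale0r.
  by exists (c * a + b); rewrite // scalerDl scalerA.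
have t0 : t != 0 by apply/eqP => t0; apply: nKt; rewrite t0; apply: subspace0.
have [v [c _ <-]|D [sD KD WD dec]] := complement sW sK.
  have [-> _|c0] := eqVneq c 0; first by rewrite scale0r.
  by move=> Kct; case: nKt; apply: subspaceZr Kct.
have /choice[f fP] : forall v, exists c, D (v - c *: t).
  by move=> v; have [_ [c _ <-] Dc] := dec v; exists c.
have funi v c : D (v - c *: t) -> f v = c.
  move=> Dc; apply/eqP; rewrite -subr_eq0; apply/eqP.
  have /eqP : (f v - c) *: t = 0.
    apply: WD; first by exists (f v - c).
    rewrite scalerBl; have := subspaceB sD Dc (fP v).
    by rewrite opprB addrC addrA addrNK.
  by rewrite scaler_eq0 (negPf t0) orbF => /eqP.
have [c u v|phi phiE] := @scalar_of f.
  apply: funi; rewrite scalerDl -scalerA opprD addrACA -scalerBr.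
  exact: subspaceZD.
exists phi; split=> [v /KD Dv|]; rewrite phiE; apply: funi.
  by rewrite scale0r subr0.
by rewrite scale1r subrr; apply: subspace0.
Qed.

(** The hypothesis says that [t] lies outside the sum of [K], [K'] and the line
    through [v]. *)
Lemma separation_sum K K' v t : is_subspace K -> is_subspace K' ->
  (forall c u, K u -> ~ K' (t - c *: v - u)) ->
  exists phi : {scalar V}, [/\ forall u, K u -> phi u = 0,
    forall u, K' u -> phi u = 0, phi v = 0 & phi t = 1].
Proof.
move=> sK sK' sep.
pose S : set V := [set u | exists c w, K w /\ K' (u - c *: v - w)].
have sS : is_subspace S.
  apply: subspaceP => [|c u1 u2 [c1 [w1 [Kw1 K1]]] [c2 [w2 [Kw2 K2]]]].
    by exists 0, 0; rewrite scale0r !subr0; split; apply: subspace0.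
  exists (c * c1 + c2), (c *: w1 + w2); split; first exact: subspaceZD.
  have -> : c *: u1 + u2 - (c * c1 + c2) *: v - (c *: w1 + w2) =
      c *: (u1 - c1 *: v - w1) + (u2 - c2 *: v - w2).
    rewrite scalerDl -scalerA !opprD !scalerBr.
    by rewrite [X in X + _ = _]addrACA [LHS]addrACA.
  exact: subspaceZD.
have [[c [w [Kw K'u]]]|phi [phiS phit]] := separation (t := t) sS.
  exact: sep Kw K'u.
exists phi; split=> // [u Ku|u K'u|]; apply: phiS.
- by exists 0, u; rewrite scale0r subr0 subrr; split=> //; apply: subspace0.
- by exists 0, 0; rewrite scale0r !subr0; split=> //; apply: subspace0.
by exists 1, 0; rewrite scale1r subrr subr0; split; apply: subspace0.
Qed.

(** At each vector only finitely many terms survive, so that the infinite sum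
    of the rank one maps [phi j (.) *: u j] makes sense. *)
Lemma locally_finite_sum (phi : nat -> {scalar V}) (u : nat -> V) :
  (forall v, exists n, forall j, (n <= j)%N -> phi j v = 0) ->
  exists y : {linear V -> V},
    forall v n, (forall j, (n <= j)%N -> phi j v = 0) ->
    y v = \sum_(j < n) phi j v *: u j.
Proof.
move=> /choice[N NP]; pose f v := \sum_(j < N v) phi j v *: u j.
have fE v n : (forall j, (n <= j)%N -> phi j v = 0) ->
    f v = \sum_(j < n) phi j v *: u j.
  move=> nP; wlog nN : n {nP} / (N v <= n)%N => [th|].
    rewrite (th (n + N v)%N) ?leq_addl// big_split_ord /=.
    rewrite [X in _ + X]big1 ?addr0// => i _.
    by rewrite nP ?scale0r// leq_addr.
  rewrite -(subnKC nN) big_split_ord /= [X in _ = _ + X]big1 ?addr0// => i _.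
  by rewrite NP ?scale0r// leq_addr.
have [c v w|y yE] := @linear_of f.
  rewrite (@fE _ (maxn (N v) (N w))); last first.
    by move=> j; rewrite geq_max => /andP[vj wj]; rewrite linearP /= !NP // mulr0 addr0.
  rewrite (@fE v (maxn (N v) (N w))); last first.
    by move=> j; rewrite geq_max => /andP[vj wj]; apply: NP.
  rewrite (@fE w (maxn (N v) (N w))); last first.
    by move=> j; rewrite geq_max => /andP[vj wj]; apply: NP.
  rewrite scaler_sumr -big_split; apply: eq_bigr => i _.
  by rewrite linearP scalerDl scalerA.
by exists y => v n /fE <-; apply: yE.
Qed.

Lemma square_zero_gl (y : {linear V -> V}) : (forall v, y (y v) = 0) ->
  exists h : gl V, (forall v, h v = v + y v) /\ (forall v, (h^-1)%g v = v - y v).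
Proof.
move=> yy; have lin : linear (fun v => v + y v).
  by move=> c u v /=; rewrite linearP scalerDr addrACA.
have K1 : cancel (fun v => v + y v) (fun v => v - y v).
  by move=> v /=; rewrite linearD yy addr0 addrK.
have K2 : cancel (fun v => v - y v) (fun v => v + y v).
  by move=> v /=; rewrite linearB yy subr0 addrNK.
exists (GL lin (Bijective K1 K2)); split=> // v.
by apply: (can_inj K1); rewrite K2; apply: (gl_inv_funK (GL lin (Bijective K1 K2))).
Qed.

End LinearAlgebra.

(** * Stability groups of series *)

Section GeneralLinear.
Local Open Scope ring_scope.
Variables (F : fieldType) (V : lmodType F).
Implicit Types (g h : gl V) (v : V).

Lemma gl_mulE g h v : (g * h)%g v = h (g v).
Proof. by []. Qed.

Lemma gl_oneE v : (1%g : gl V) v = v.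
Proof. by []. Qed.

Lemma gl_mulVE g v : (g^-1)%g (g v) = v.
Proof. exact: gl_funK. Qed.

Lemma gl_mulgV g v : g ((g^-1)%g v) = v.
Proof. exact: gl_inv_funK. Qed.

Definition gl_sub1 g v := g v - v.

Lemma gl_sub1_linear g : linear (gl_sub1 g).
Proof. by move=> c u v; rewrite /gl_sub1 linearP opprD addrACA -scalerBr. Qed.

HB.instance Definition _ g :=
  GRing.isLinear.Build F V V *:%R (gl_sub1 g) (gl_sub1_linear g).

Lemma gl_sub1E g v : g v = gl_sub1 g v + v.
Proof. by rewrite subrK. Qed.

Lemma iter_linear n (f : {linear V -> V}) c u v :
  iter n f (c *: u + v) = c *: iter n f u + iter n f v.
Proof. by elim: n => //= n ->; rewrite linearP. Qed.

(** The vectors whose whole [(g - 1)]-orbit is killed by the functionals with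
    index in [P]: a [g]-stable subspace by construction. *)
Definition killed (phi : nat -> {scalar V}) g (P : pred nat) : set V :=
  [set v | forall i n, P i -> phi i (iter n (gl_sub1 g) v) = 0].

Lemma killed_subspace phi g P : is_subspace (killed phi g P).
Proof.
apply: subspaceP => [i n _|c u w ku kw i n Pi].
  by rewrite -[0](subrr 0) -scaleN1r addrC iter_linear linearP /= mulN1r addNr.
by rewrite iter_linear linearP /= ku ?kw// mulr0 addr0.
Qed.

Lemma killed_stable phi g P v : killed phi g P v -> killed phi g P (g v).
Proof.
move=> kv; rewrite gl_sub1E; apply: (subspaceD (killed_subspace _ _ _)) => // i n Pi.
by rewrite -iterSr; apply: kv.
Qed.

Lemma killed_phi phi g (P : pred nat) i v : P i -> killed phi g P v -> phi i v = 0.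
Proof. by move=> Pi /(_ i 0%N Pi). Qed.

Lemma sub_killed phi g (P P' : pred nat) : {subset P' <= P} ->
  killed phi g P `<=` killed phi g P'.
Proof. by move=> PP v kv i n /PP; apply: kv. Qed.

End GeneralLinear.

Section Stability.
Local Open Scope ring_scope.
Variables (F : fieldType) (V : lmodType F) (L : set (set V)).
Hypothesis serL : subspace_series L.
Implicit Types (B T U W : set V) (g h : gl V) (u v : V).

Lemma series_subspace W : L W -> is_subspace W.
Proof. by case: serL => + _ _ _ _; apply. Qed.

Lemma series_mem0 W : L W -> W 0.
Proof. by move=> LW; apply: subspace0; apply: series_subspace. Qed.

Lemma series_total W W' : L W -> L W' -> W `<=` W' \/ W' `<=` W.
Proof. by case: serL => _ + _ _ _; apply. Qed.

Lemma series0 : L [set 0].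
Proof. by case: serL => _ _ [] . Qed.

Lemma seriesT : L setT.
Proof. by case: serL => _ _ []. Qed.

Lemma series_cap FF : FF `<=` L -> L (\bigcap_(W in FF) W).
Proof. by case: serL => _ _ _ + _; apply. Qed.

Lemma series_cup FF : FF `<=` L -> FF !=set0 -> L (\bigcup_(W in FF) W).
Proof. by case: serL => _ _ _ _; apply. Qed.

Lemma series_bigcup (W : nat -> set V) : (forall n, L (W n)) -> L (\bigcup_n W n).
Proof.
move=> LW; rewrite -(bigcup_image [set: nat] W id).
by apply: series_cup => [_ [n _ <-]//|]; exists (W 0%N), 0%N.
Qed.

Lemma series_le W W' v : L W -> L W' -> W v -> ~ W' v -> W' `<=` W.
Proof. by move=> LW LW' Wv W'v; have [/(_ v Wv)|] := series_total LW LW'. Qed.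

(** The jump at [v] has as top the intersection of the members containing [v]
    and as bottom the union of the others. *)
Lemma series_jump_of v : v != 0 -> exists B T,
  [/\ jump L B T, T v, ~ B v & forall W, L W -> ~ W v -> W `<=` B].
Proof.
move=> v0; pose BB := [set W | L W /\ ~ W v]; pose TT := [set W | L W /\ W v].
have BBL : BB `<=` L by move=> W [].
have TTL : TT `<=` L by move=> W [].
have B0 : BB [set 0] by split; [exact: series0 | move=> /= v0'; case/eqP: v0].
exists (\bigcup_(W in BB) W), (\bigcap_(W in TT) W).
have LB : L (\bigcup_(W in BB) W) by apply: series_cup => //; exists [set 0].
have LT := series_cap TTL.
have nBv : ~ (\bigcup_(W in BB) W) v by case=> W [].
have Tv : (\bigcap_(W in TT) W) v by move=> W [].
split=> // [|W LW nWv u Wu]; last by exists W.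
split=> //; first by split=> [|/(_ v Tv)//]; exact: (series_le LT LB Tv nBv).
case=> W [LW [_ nWB] [_ nTW]].
have [Wv|nWv] := pselect (W v); first by apply: nTW => u; apply.
by apply: nWB => u Wu; exists W.
Qed.

Lemma stability_groupE g :
  stability_group L g <->
  forall B T v, jump L B T -> T v -> B (gl_sub1 g v).
Proof.
split=> [Sg B T v jBT Tv|Sg B T jBT _ [v Tv <-]]; last exact: Sg jBT Tv.
by apply: (Sg _ _ jBT); exists v.
Qed.

Lemma stability_drop g v : stability_group L g -> v != 0 ->
  exists B, [/\ L B, ~ B v, B (gl_sub1 g v) & forall W, L W -> ~ W v -> W `<=` B].
Proof.
move=> /stability_groupE Sg /series_jump_of[B [T [jBT Tv nBv WB]]].
by exists B; split=> //; [case: jBT | apply: Sg jBT Tv].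
Qed.

Lemma stability_sub1 g W v : stability_group L g -> L W -> W v -> W (gl_sub1 g v).
Proof.
move=> Sg LW Wv; have sW := series_subspace LW.
have [->|v0] := eqVneq v 0; first by rewrite linear0; apply: subspace0.
have [B [LB nBv Bx _]] := stability_drop Sg v0.
exact: (series_le LW LB Wv nBv).
Qed.

Lemma stability_sub1_iter g W v n :
  stability_group L g -> L W -> W v -> W (iter n (gl_sub1 g) v).
Proof. by move=> Sg LW Wv; elim: n => //= n IHn; apply: stability_sub1. Qed.

Lemma stability_stable g W v : stability_group L g -> L W -> W v -> W (g v).
Proof.
move=> Sg LW Wv; rewrite gl_sub1E.
by apply: subspaceD => //; [exact: series_subspace | exact: stability_sub1].
Qed.

(** Modulo a member of the series not containing [v], the image of [v] under
    [g - 1] lies strictly below [v]; hence [g - 1] has no nonzero eigenvalue on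
    any section of the series. *)
Lemma stability_no_eigenvalue g U v c : stability_group L g -> L U -> ~ U v ->
  U (gl_sub1 g v - c *: v) -> c = 0.
Proof.
move=> Sg LU nUv Ux; apply/eqP; apply: contrapT => /negP c0.
have v0 : v != 0.
  by apply/eqP => v0; apply: nUv; rewrite v0; exact: series_mem0.
have [B [LB nBv Bx UB]] := stability_drop Sg v0.
have sB := series_subspace LB.
exact: nBv (subspaceZr sB c0 (subspaceBr sB Bx (UB U LU nUv _ Ux))).
Qed.

Lemma stability_stableV g W v :
  stability_group L g -> L W -> W v -> W ((g^-1)%g v).
Proof.
move=> Sg LW Wv; set u := (g^-1)%g v.
have gu : g u = v by exact: gl_mulgV.
apply: contrapT => nWu; have := stability_no_eigenvalue (c := -1) Sg LW nWu.
rewrite scaleN1r opprK -gl_sub1E gu => /(_ Wv)/eqP.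
by rewrite oppr_eq0 oner_eq0.
Qed.

Lemma stability_subgroup : subgroup (stability_group L).
Proof.
apply: subgroupP => [|g h Sg Sh|g Sg].
- apply/stability_groupE => B T v [LB _ _ _] _.
  by rewrite /gl_sub1 gl_oneE subrr; exact: series_mem0.
- have Sg' := Sg; have Sh' := Sh.
  move/stability_groupE: Sg' => Sg'; move/stability_groupE: Sh' => Sh'.
  apply/stability_groupE => B T v jBT Tv; have [LB LT _ _] := jBT.
  have -> : gl_sub1 (g * h)%g v = gl_sub1 h (g v) + gl_sub1 g v.
    by rewrite /gl_sub1 gl_mulE addrA subrK.
  apply: subspaceD; [exact: series_subspace| |exact: Sg' jBT Tv].
  by apply: Sh' jBT _; apply: stability_stable.
apply/stability_groupE => B T v jBT Tv; have [LB LT _ _] := jBT.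
have -> : gl_sub1 (g^-1)%g v = - gl_sub1 g ((g^-1)%g v).
  by rewrite /gl_sub1 gl_mulgV opprB.
apply: subspaceN; first exact: series_subspace.
by move/stability_groupE: (Sg) => Sg'; apply: Sg' jBT _; apply: stability_stableV.
Qed.

End Stability.

(** * Finite subseries *)

Section FiniteChains.
Variable T : Type.
Implicit Types FF : set (set T).

Lemma finite_chain_min FF : finite_set FF -> FF !=set0 ->
  (forall A B, FF A -> FF B -> A `<=` B \/ B `<=` A) ->
  exists2 A, FF A & forall B, FF B -> A `<=` B.
Proof.
move=> /finite_seqP[s ->]; elim: s => [[A]//|A s IHs _] tot.
have [[A0 A0s]|s0] := pselect ([set` s] !=set0); last first.
  exists A => [|B]; first by rewrite /= mem_head.
  by rewrite /= inE => /orP[/eqP->//|Bs]; case: s0; exists B.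
have [||B Bs Bmin] := IHs; first by exists A0.
  by move=> B C Bs Cs; apply: tot; rewrite /= inE ?Bs ?Cs orbT.
have [||AB|BA] := tot A B; rewrite /= ?inE ?eqxx ?Bs ?orbT//.
  exists A => [|C]; rewrite /= ?inE ?eqxx// => /orP[/eqP->//|/Bmin BC].
  exact: subset_trans BC.
exists B => [|C]; rewrite /= ?inE ?eqxx ?Bs ?orbT// => /orP[/eqP->//|].
exact: Bmin.
Qed.

Lemma finite_chain_max FF : finite_set FF -> FF !=set0 ->
  (forall A B, FF A -> FF B -> A `<=` B \/ B `<=` A) ->
  exists2 A, FF A & forall B, FF B -> B `<=` A.
Proof.
move=> finF [A0 FA0] tot.
have [|||A [B FB <-] Amin] := @finite_chain_min (setC @` FF).
- exact: finite_image.
- by exists (~` A0), A0.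
- by move=> _ _ [A FA <-] [B FB <-]; have [AB|BA] := tot _ _ FA FB;
    [right|left]; apply: subsetC.
exists B => // C FC; rewrite -subsetCP; apply: Amin.
by exists C.
Qed.

End FiniteChains.

Section Subseries.
Local Open Scope ring_scope.
Variables (F : fieldType) (V : lmodType F).
Implicit Types (L M N : set (set V)) (B T U W : set V) (g h : gl V) (u v : V).

Lemma finite_subseries L M : subspace_series L -> M `<=` L -> finite_set M ->
  M [set 0] -> M setT -> subseries M L.
Proof.
move=> serL ML finM M0 MT; split=> //.
have tot FF : FF `<=` M ->
    forall A B, FF A -> FF B -> A `<=` B \/ B `<=` A.
  by move=> FM A B FA FB; apply: (series_total serL); apply/ML/FM.
split=> [W /ML|W W'||FF FM|FF FM F0]; first exact: series_subspace.
- exact: tot.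
- by [].
- have [F0|] := pselect (FF !=set0); last first.
    move/set0P/negP; rewrite negbK => /eqP->.
    by rewrite bigcap_set0.
  have [W FW Wmin] := finite_chain_min (sub_finite_set FM finM) F0 (tot _ FM).
  suff -> : \bigcap_(W in FF) W = W by apply: FM.
  by apply/seteqP; split=> v; [exact | move=> Wv B FB; exact: Wmin Wv].
- have [W FW Wmax] := finite_chain_max (sub_finite_set FM finM) F0 (tot _ FM).
  suff -> : \bigcup_(W in FF) W = W by apply: FM.
  by apply/seteqP; split=> v; [case=> B FB; exact: Wmax | exists W].
Qed.

(** Each jump of the finer series lies inside a jump of the coarser one. *)
Lemma stability_groupS M L : subspace_series M -> subspace_series L ->
  M `<=` L -> stability_group M `<=` stability_group L.
Proof.
move=> serM serL ML g /stability_groupE Sg; apply/stability_groupE.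
move=> B T v [LB LT [BT nTB] noW] Tv.
pose BB := [set W | M W /\ W `<=` B]; pose TT := [set W | M W /\ T `<=` W].
have BBB : \bigcup_(W in BB) W `<=` B by move=> u [W [_]]; apply.
have TTT : T `<=` \bigcap_(W in TT) W by move=> u Tu W [_]; apply.
apply: (BBB); apply: (Sg _ (\bigcap_(W in TT) W)); last exact: (TTT).
split.
- apply: (series_cup serM) => [W []//|]; exists [set 0]; split.
    exact: series0 serM.
  by move=> _ ->; exact: (series_mem0 serL).
- by apply: (series_cap serM) => W [].
- split=> [u /BBB /BT /TTT//|TB]; apply: nTB => u /TTT/TB/BBB; exact.
case=> W [MW [_ nWB] [_ nTW]]; apply: noW; exists W; split; first exact: ML.
  have [WB|BW] := series_total serL (ML _ MW) LB.
    by exfalso; apply: nWB => u Wu; exists W.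
  by split=> // WB; apply: nWB => u Wu; exists W.
have [WT|TW] := series_total serL (ML _ MW) LT.
  by split=> // TW; apply: nTW => u; apply; split.
by exfalso; apply: nTW => u; apply; split.
Qed.

(** This set turns out to be the Hirsch-Plotkin radical of the stability
    group. *)
Definition finite_stabilizer L : set (gl V) :=
  [set g | exists M, [/\ subseries M L, finite_set M & stability_group M g]].

Lemma finite_stabilizer_stability L : subspace_series L ->
  finite_stabilizer L `<=` stability_group L.
Proof. by move=> serL g [M [[ML serM] _]]; apply: stability_groupS. Qed.

(** Two finite subseries have a common finite refinement. *)
Lemma finite_stabilizer_subgroup L : subspace_series L ->
  subgroup (finite_stabilizer L).
Proof.
move=> serL; apply: subgroupP => [|g h [M [sM finM Sg]] [N [sN finN Sh]]|g [M [sM finM Sg]]].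
- have finM : finite_set [set [set 0]; setT : set V] by exact: finite_set2.
  have sM : subseries [set [set 0]; setT : set V] L.
    apply: finite_subseries => //; [|by left|by right].
    by move=> _ [] ->; [exact: series0 | exact: seriesT].
  exists [set [set 0]; setT]; split=> //.
  apply: subgroup1; apply: stability_subgroup.
  by case: sM.
- have finMN : finite_set (M `|` N) by rewrite finite_setU.
  have sMN : subseries (M `|` N) L.
    apply: finite_subseries => //; first by case: sM sN => ML _ [NL _] W [/ML|/NL].
      by left; apply: series0; case: sM.
    by left; apply: seriesT; case: sM.
  have [[_ serM] [_ serN] [_ serMN]] := And3 sM sN sMN.
  exists (M `|` N); split=> //; apply: (subgroupM (H := stability_group _)).
  + exact: stability_subgroup.
  + by apply: (stability_groupS serM serMN _ Sg); exact: subsetUl.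
  + by apply: (stability_groupS serN serMN _ Sh); exact: subsetUr.
exists M; split=> //; apply: (subgroupV (H := stability_group _)) => //; apply: stability_subgroup.
by case: sM.
Qed.

(** The stability group of [L] maps each member of [M] onto itself, and hence
    each jump of [M] too. *)
Lemma stability_group_normal M L : subspace_series L -> subseries M L ->
  normal_subgroup (stability_group M) (stability_group L).
Proof.
move=> serL [ML serM]; split; first exact: stability_subgroup.
  exact: stability_groupS.
move=> g h /stability_groupE Sg Sh; apply/stability_groupE => B T v jBT Tv.
have [/ML LB /ML LT _ _] := jBT.
have -> : gl_sub1 (g ^ h)%g v = h (gl_sub1 g ((h^-1)%g v)).
  by rewrite /gl_sub1 linearB /= gl_mulgV.
apply: (stability_stable serL) => //; apply: Sg jBT _.
exact: (stability_stableV serL).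
Qed.

End Subseries.

(** * Stability groups of finite series are nilpotent *)

Section FiniteSeriesNilpotent.
Local Open Scope ring_scope.
Variables (F : fieldType) (V : lmodType F) (M : set (set V)).
Hypotheses (serM : subspace_series M) (finM : finite_set M).
Implicit Types (W : set V) (g h : gl V) (v : V).

Definition next_member W : set V := \bigcap_(U in [set U | M U /\ W `<` U]) U.

Lemma next_member_in W : M (next_member W).
Proof. by apply: (series_cap serM) => U []. Qed.

Lemma sub_next_member W : W `<=` next_member W.
Proof. by move=> v Wv U [_ [WU _]]; exact: WU. Qed.

Lemma next_member_jump W : M W -> W <> setT -> jump M W (next_member W).
Proof.
move=> MW WT; pose FF := [set U | M U /\ W `<` U].
have FFM : FF `<=` M by move=> U [].
have [|A B FA FB|U [MU WU] Umin] := @finite_chain_min _ FF (sub_finite_set FFM finM).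
- exists setT; split; first exact: seriesT serM.
  by split=> // TW; apply: WT; apply/seteqP; split.
- by apply: (series_total serM); apply: FFM.
have eU : next_member W = U.
  by apply/seteqP; split=> v; [apply | move=> Uv A FA; exact: Umin Uv].
rewrite eU; split=> // -[A [MA WA [_ nUA]]]; apply: nUA; exact: Umin.
Qed.

(** The enumeration of the series from the bottom, which stays at [setT] once
    it arrives there. *)
Definition member n : set V := iter n next_member [set 0].

Lemma member_in n : M (member n).
Proof. case: n => [|n]; [exact: series0 serM | exact: next_member_in]. Qed.

Lemma member_le m n : (m <= n)%N -> member m `<=` member n.
Proof.
move=> /subnKC <-; elim: (n - m)%N => [|k IHk]; first by rewrite addn0.
by rewrite addnS; apply: subset_trans IHk _; exact: sub_next_member.
Qed.

(** An enumeration that never reached the top would embed [nat] in [M]. *)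
Lemma member_setT : exists n, member n = setT.
Proof.
apply: contrapT => nT.
have jmp n : jump M (member n) (member n.+1).
  by apply: next_member_jump; [exact: member_in | move=> nT'; apply: nT; exists n].
apply: infinite_nat; have -> : [set: nat] = member @^-1` M.
  by apply/seteqP; split=> // n _; exact: member_in.
apply: finite_preimage finM => m n _ _ emn.
have [mn|nm|//] := ltngtP m n.
- have [_ _ [_ []]] := jmp m.
  by rewrite emn; exact: member_le.
- have [_ _ [_ []]] := jmp n.
  by rewrite -emn; exact: member_le.
Qed.

Lemma stability_member g i v : stability_group M g ->
  member i.+1 v -> member i (gl_sub1 g v).
Proof.
move=> Sg Wv; have [iT|iT] := pselect (member i = setT); first by rewrite iT.
move/stability_groupE: Sg => Sg; apply: Sg Wv.
by apply: next_member_jump => //; exact: member_in.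
Qed.

(** Commuting an element that moves the enumeration down by [k.+1] steps with
    one that moves it down by one step gives [k.+2] steps, so these subgroups
    contain the terms of the lower central series. *)
Definition shifting k : set (gl V) :=
  [set g | stability_group M g /\
    forall i v, member (i + k).+1 v -> member i (gl_sub1 g v)].

Lemma shifting_subgroup k : subgroup (shifting k).
Proof.
have sS := stability_subgroup serM.
apply: subgroupP => [|g h [Sg gk] [Sh hk]|g [Sg gk]]; split.
- exact: (subgroup1 sS).
- by move=> i v _; rewrite /gl_sub1 subrr; exact: series_mem0 (member_in i).
- exact: subgroupM sS Sg Sh.
- move=> i v Wv; have -> : gl_sub1 (g * h)%g v = gl_sub1 h (g v) + gl_sub1 g v.
    by rewrite /gl_sub1 gl_mulE addrA subrK.
  apply: subspaceD; [exact: series_subspace (member_in i)| |exact: gk].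
  by apply: hk; exact: (stability_stable serM Sg (member_in _) Wv).
- exact: subgroupV sS Sg.
move=> i v Wv; have -> : gl_sub1 (g^-1)%g v = - gl_sub1 g ((g^-1)%g v).
  by rewrite /gl_sub1 gl_mulgV opprB.
apply: subspaceN; first exact: series_subspace (member_in i).
by apply: gk; exact: (stability_stableV serM Sg (member_in _) Wv).
Qed.

(** The commutator of two elements compares their products in both orders;
    there the linear terms cancel. *)
Lemma commutator_sub1 g h u : gl_sub1 [~ g, h]%g ((h * g)%g u) =
  gl_sub1 h (gl_sub1 g u) - gl_sub1 g (gl_sub1 h u).
Proof.
rewrite {1}/gl_sub1 -gl_mulE.
have -> : (h * g * [~ g, h] = g * h)%g.
  by rewrite /commg /conjg !mulgA mulgK mulgV mul1g.
have cancel4 a b c d e : a - b - (c - d) - (e - c - (b - d)) = a - e :> V.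
  have subBB x y : x - y - (c - d) = x - (y + (c - d)) by rewrite -addrA -opprD.
  have -> : e - c - (b - d) = e - (b + (c - d)).
    by rewrite -addrA -opprD addrCA.
  by rewrite subBB opprB addrA subrK.
by rewrite /gl_sub1 !gl_mulE (linearB h) (linearB g) /= cancel4.
Qed.

Lemma stability_group_nilpotent : nilpotent_group (stability_group M).
Proof.
have sS := stability_subgroup serM; split=> //.
have lcs k : lower_central (stability_group M) k `<=` shifting k.
  elim: k => [g Sg|k IHk /=].
    by split=> // i v; rewrite addn0; exact: stability_member.
  apply: generated_min; first exact: shifting_subgroup.
  move=> _ [g [h [/IHk[Sg gk] Sh ->]]]; split.
    by rewrite commgEl; repeat apply: (subgroupM sS) => //; apply: (subgroupV sS).
  move=> i v Wv; pose u := ((h * g)^-1)%g v.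
  rewrite -(gl_mulgV (h * g)%g v) -/u commutator_sub1.
  have Wu : member (i + k).+2 u.
    rewrite addnS in Wv.
    exact: (stability_stableV serM (subgroupM sS Sh Sg) (member_in _) Wv).
  apply: subspaceB; first exact: series_subspace (member_in i).
    by apply: stability_member => //; apply: gk.
  by apply: gk; apply: stability_member.
have [n nT] := member_setT; exists n; apply/seteqP; split=> [g /lcs[_ gn]|_ ->].
  apply: gl_eqP => v; apply/eqP; rewrite -subr_eq0; apply/eqP; apply: (gn 0%N).
  by apply: (member_le (leqnSn n)); rewrite nT.
exact: lower_central1.
Qed.

End FiniteSeriesNilpotent.

(** * Transvections and left Engel elements *)

Section Transvections.
Local Open Scope ring_scope.
Variables (F : fieldType) (V : lmodType F) (L : set (set V)).
Hypothesis serL : subspace_series L.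
Implicit Types (B T X Z W : set V) (g h a : gl V) (u v w : V).

(** A functional that kills [Z] can only be nonzero on jumps above [Z]; this is
    why a transvection from it into [Z] stabilizes the series. *)
Lemma jump_annihilator B T Z (phi : {scalar V}) v : jump L B T -> L Z ->
  (forall z, Z z -> phi z = 0) -> T v -> phi v != 0 -> Z `<=` B.
Proof.
move=> [LB LT BT noW] LZ phiZ Tv phiv.
have nZv : ~ Z v by move=> /phiZ/eqP; apply/negP.
have [//|BZ] := series_total serL LZ LB.
have ZT := series_le serL LT LZ Tv nZv.
apply: contrapT => nZB; apply: noW; exists Z; split=> //.
by split=> // TZ; apply: nZv; apply: TZ.
Qed.

Lemma stable_square_zero (y : {linear V -> V}) : (forall v, y (y v) = 0) ->
  (forall B T v, jump L B T -> T v -> B (y v)) ->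
  exists h, [/\ stability_group L h, forall v, h v = v + y v
    & forall v, (h^-1)%g v = v - y v].
Proof.
move=> yy Sy; have [h [hE hVE]] := square_zero_gl yy; exists h; split=> //.
apply/stability_groupE => B T v jBT Tv.
by rewrite /gl_sub1 hE addrC addKr; apply: Sy Tv.
Qed.

Lemma stable_transvection X (phi : {scalar V}) w : L X -> X w ->
  (forall v, X v -> phi v = 0) ->
  exists2 h, stability_group L h & forall v, gl_sub1 h v = phi v *: w.
Proof.
move=> LX Xw phiX; have [c u v|y yE] := @linear_of _ V (fun v => phi v *: w).
  by rewrite linearP scalerDl scalerA.
have [v|B T v jBT Tv|h [Sh hE _]] := @stable_square_zero y.
- by rewrite !yE linearZ /= (phiX w Xw) mulr0 scale0r.
- rewrite yE; have [->|phiv] := eqVneq (phi v) 0.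
    by rewrite scale0r; apply: (series_mem0 serL); case: jBT.
  apply: subspaceZ; first by apply: (series_subspace serL); case: jBT.
  exact: (jump_annihilator jBT LX phiX Tv phiv).
by exists h => // v; rewrite /gl_sub1 hE yE addrC addKr.
Qed.

(** The conditions [phi i (p j) = 0] make the sum [y] of the transvections
    square to zero, which gives [1 + y] the inverse [1 - y]. *)
Lemma stable_transvections (phi : nat -> {scalar V}) (p : nat -> V)
    (Z : nat -> set V) :
  (forall i, [/\ L (Z i), Z i (p i) & forall v, Z i v -> phi i v = 0]) ->
  (forall i j, phi i (p j) = 0) ->
  (forall v, exists n, forall j, (n <= j)%N -> phi j v = 0) ->
  exists (y : {linear V -> V}) h,
    [/\ forall v n, (forall j, (n <= j)%N -> phi j v = 0) ->
          y v = \sum_(j < n) phi j v *: p j,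
        stability_group L h, forall v, h v = v + y v
      & forall v, (h^-1)%g v = v - y v].
Proof.
move=> ZP phip fin; have [y yE] := locally_finite_sum p fin.
have [v|B T v jBT Tv|h hP] := @stable_square_zero y.
- have [n /yE->] := fin v; rewrite linear_sum big1// => i _.
  rewrite linearZ /= (yE (p i) 0%N) ?big_ord0 ?scaler0//.
- have [n /yE->] := fin v; have sB : is_subspace B.
    by apply: (series_subspace serL); case: jBT.
  apply: subspace_sum => // i _.
  have [->|phiv] := eqVneq (phi i v) 0.
    by rewrite scale0r; apply: subspace0.
  have [LZ Zp phiZ] := ZP i; apply: subspaceZ => //.
  exact: (jump_annihilator jBT LZ phiZ Tv phiv).
by exists y, h; case: hP.
Qed.

(** The powers of [g - 1] move [w] into ever smaller members of the series, so
    the lowest term of a linear relation cannot be cancelled by the others. *)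
Lemma stability_dependence g w n (c : nat -> F) : stability_group L g ->
  \sum_(i < n.+1) c i *: iter i (gl_sub1 g) w = 0 -> c n != 0 ->
  iter n (gl_sub1 g) w = 0.
Proof.
move=> Sg; elim: n w c => [|n IHn] w c.
  by rewrite big_ord1 /= => /eqP; rewrite scaler_eq0 => /orP[->//|/eqP].
rewrite big_ord_recl /= => cw cn; have [c0|c0] := eqVneq (c 0%N) 0.
  rewrite -iterS iterSr; apply: (IHn _ (fun i => c i.+1)) => //.
  rewrite -[RHS]cw c0 scale0r add0r; apply: eq_bigr => i _.
  by rewrite /= -iterSr.
have [->|w0] := eqVneq w 0.
  by elim: n {IHn cw cn} => [|n /= ->]; rewrite /= !linear0.
have [B [LB nBw Bx _]] := stability_drop serL Sg w0; exfalso; apply: nBw.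
have sB := series_subspace serL LB; apply: (subspaceZr sB c0).
apply: (subspaceDr sB _ (v := \sum_(i < n.+1) c i.+1 *: iter i.+1 (gl_sub1 g) w)).
  apply: subspace_sum => // i _.
  by apply: subspaceZ => //; rewrite iterSr; apply: (stability_sub1_iter serL).
by rewrite cw; apply: subspace0.
Qed.

Definition bracket (b f : V -> V) v := b (f v) - f (b v).

Lemma iter_gl_sub1 a n v :
  iter n a (gl_sub1 a v) = gl_sub1 a (iter n a v).
Proof. by elim: n => //= n ->; rewrite /gl_sub1 linearB. Qed.

(** On the group of [c] that act trivially on [X] and modulo [X], which is
    abelian, taking commutators with [a] amounts to bracketing with [a - 1],
    up to a power of [a]. *)
Lemma commutator_bracket X a h n v : stability_group L a -> L X ->
  (forall v, X (gl_sub1 h v)) -> (forall v, X v -> gl_sub1 h v = 0) ->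
  gl_sub1 (iter n (fun c => [~ c, a]%g) h) (iter n a v) =
  iter n (bracket (gl_sub1 a)) (gl_sub1 h) v.
Proof.
move=> Sa LX hX h0.
have cancel3 p q r s : p + q - r - q = p - s - (r - s) :> V.
  by rewrite opprB addrA subrK addrAC addrK.
have step c : (forall v, X (gl_sub1 c v)) -> (forall v, X v -> gl_sub1 c v = 0) ->
    forall v, gl_sub1 [~ c, a]%g (a v) = bracket (gl_sub1 a) (gl_sub1 c) v.
  move=> cX c0 u; have cV w : (c^-1)%g w = w - gl_sub1 c w.
    apply: (can_inj (gl_funK c)); rewrite gl_mulgV gl_sub1E linearB /= (c0 _ (cX w)).
    by rewrite subr0 addrC subrK.
  pose t := (a^-1)%g (gl_sub1 c (a u)).
  have ct : c t = t by rewrite gl_sub1E c0 ?add0r//; apply: (stability_stableV serL).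
  have e1 : (c^-1)%g (a u) = a (u - t) by rewrite cV (linearB a) /= gl_mulgV.
  have e2 : [~ c, a]%g (a u) = a (c u - t).
    have -> : [~ c, a]%g (a u) = a (c ((a^-1)%g ((c^-1)%g (a u)))) by [].
    by rewrite e1 gl_mulVE (linearB c) /= ct.
  rewrite {1}/gl_sub1 e2 /bracket [gl_sub1 a (gl_sub1 c u)]/gl_sub1 [gl_sub1 a u]/gl_sub1 (linearB (gl_sub1 c)) /=.
  rewrite [c u]gl_sub1E (linearB a) (linearD a) /= gl_mulgV.
  exact: cancel3.
have inX c : (forall v, X (gl_sub1 c v)) -> (forall v, X v -> gl_sub1 c v = 0) ->
    (forall v, X (gl_sub1 [~ c, a]%g v)) /\
    (forall v, X v -> gl_sub1 [~ c, a]%g v = 0).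
  move=> cX c0; have sX := series_subspace serL LX; split=> w.
    rewrite -(gl_mulgV a w) step// /bracket; apply: subspaceB => //.
    exact: (stability_sub1 serL Sa LX (cX _)).
  move=> Xw; rewrite -(gl_mulgV a w) step// /bracket.
  have Xu := stability_stableV serL Sa LX Xw.
  by rewrite !c0 ?linear0 ?addr0//; exact: (stability_sub1 serL Sa LX Xu).
have inXn m : (forall v, X (gl_sub1 (iter m (fun c => [~ c, a]%g) h) v)) /\
    (forall v, X v -> gl_sub1 (iter m (fun c => [~ c, a]%g) h) v = 0).
  by elim: m => //= m [IH1 IH2]; apply: inX.
elim: n v => // n IHn v; have [cX c0] := inXn n.
rewrite !iterS step// /bracket -iter_gl_sub1 !IHn.
by [].
Qed.

(** The Engel condition, read on transvections. *)
Lemma locally_nilpotent_bracket N X (phi : {scalar V}) w a :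
  normal_subgroup N (stability_group L) -> locally_nilpotent N -> N a ->
  L X -> X w -> (forall v, X v -> phi v = 0) ->
  exists n, forall v, iter n (bracket (gl_sub1 a)) (fun v => phi v *: w) v = 0.
Proof.
move=> nN lnN Na LX Xw phiX; have Sa : stability_group L a by case: nN => _ + _; apply.
have [h Sh hE] := stable_transvection LX Xw phiX.
have [n hn] := locally_nilpotent_engel nN lnN Sh Na; exists n => v.
have -> : (fun v => phi v *: w) = gl_sub1 h by apply: funext => u; rewrite hE.
rewrite -(commutator_bracket n v Sa LX).
- by rewrite hn /gl_sub1 subrr.
- by move=> u; rewrite hE; apply: subspaceZ => //; apply: (series_subspace serL).
- by move=> u Xu; rewrite hE phiX// scale0r.
Qed.

Section LocallyNilpotent.
Variables (N : set (gl V)) (X : set V) (a : gl V).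
Hypotheses (nN : normal_subgroup N (stability_group L)).
Hypotheses (lnN : locally_nilpotent N) (Na : N a) (LX : L X).

Let Sa : stability_group L a. Proof. by case: nN => _ + _; apply. Qed.

(** The coefficient of the highest power of [a - 1] stays [phi v] under
    bracketing. *)
Lemma bracket_leading (phi : {scalar V}) w n v : exists2 c : nat -> F,
  c n = phi v & iter n (bracket (gl_sub1 a)) (fun v => phi v *: w) v =
    \sum_(i < n.+1) c i *: iter i (gl_sub1 a) w.
Proof.
elim: n v => [|n IHn] v; first by exists (fun=> phi v); rewrite // big_ord1.
have [[c cn cE] [d dn dE]] := (IHn v, IHn (gl_sub1 a v)).
exists (fun i => (if i is k.+1 then c k else 0) - (if (i <= n)%N then d i else 0)).
  by rewrite ltnn subr0.
rewrite iterS /bracket cE dE.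
under [RHS]eq_bigr do rewrite scalerBl.
rewrite sumrB; congr (_ - _).
  rewrite [RHS]big_ord_recl /= scale0r add0r linear_sum; apply: eq_bigr => i _.
  by rewrite linearZ.
rewrite [RHS]big_ord_recr /= ltnn scale0r addr0; apply: eq_bigr => i _.
by rewrite -ltnS ltn_ord.
Qed.

(** The vanishing bracket of a transvection along [w], evaluated where its
    functional is 1, makes [(a - 1)^n w] depend on the lower powers. *)
Lemma engel_vector w : X <> setT -> X w -> exists n, iter n (gl_sub1 a) w = 0.
Proof.
move=> XT Xw; have sX := series_subspace serL LX.
have [t nXt] : exists t, ~ X t.
  by apply/existsNP => allX; apply: XT; apply/seteqP; split.
have [phi [phiX phit]] := separation sX nXt.
have [n /(_ t)] := locally_nilpotent_bracket nN lnN Na LX Xw phiX.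
have [c cn ->] := bracket_leading phi w n t => c0; exists n.
by apply: (stability_dependence Sa c0); rewrite cn phit oner_eq0.
Qed.

(** The dual of [engel_vector]. With the transvection directed along a vector
    fixed by [a], bracketing acts on the functional alone. *)
Lemma engel_functional (phi : {scalar V}) : X <> setT -> X <> [set 0] ->
  (forall v, X v -> phi v = 0) ->
  exists n, forall v, phi (iter n (gl_sub1 a) v) = 0.
Proof.
move=> XT X0 phiX; have [w [Xw w0 aw]] : exists w, [/\ X w, w != 0 & gl_sub1 a w = 0].
  have [u [Xu u0]] : exists u, X u /\ u <> 0.
    apply: contrapT => noU; apply: X0; apply/seteqP; split=> [u Xu|_ ->].
      by apply: contrapT => u0; apply: noU; exists u.
    exact: (series_mem0 serL LX).
  have exn : exists n, iter n (gl_sub1 a) u == 0.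
    by have [n un] := engel_vector XT Xu; exists n; apply/eqP.
  case: (ex_minnP exn) => -[|n] /eqP un minn; first by case: u0.
  exists (iter n (gl_sub1 a) u); split=> //.
    exact: (stability_sub1_iter serL).
  by apply/negP => /minn; rewrite ltnn.
have [n nE] := locally_nilpotent_bracket nN lnN Na LX Xw phiX; exists n => v.
have brE m u : iter m (bracket (gl_sub1 a)) (fun v => phi v *: w) u =
    ((-1) ^+ m * phi (iter m (gl_sub1 a) u)) *: w.
  elim: m u => [|m IHm] u; first by rewrite mul1r.
  rewrite iterS /bracket !IHm linearZ /= aw scaler0 sub0r -scaleNr exprS.
  by rewrite mulN1r mulNr -iterSr.
have /eqP := nE v; rewrite brE scaler_eq0 (negPf w0) orbF mulf_eq0.
by rewrite signr_eq0 => /eqP.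
Qed.

End LocallyNilpotent.

End Transvections.

(** * Growth under [g * g ^ h] *)

(** Let [h = 1 + y], where [y] sends [E j] into itself up to the new vector
    [p j.+1], with coefficient [phi j]. If [z] lies in [E j] and [phi j] does
    not vanish on [g z], then applying [g] and then [h] or its inverse reaches
    [E j.+1], and the result is again visible through [phi j.+1], because
    [phi j.+1] kills [E j] and is 1 on [g (p j.+1)]. Two such steps form one
    application of [g * g ^ h], so that powers of [g * g ^ h - 1] do not kill
    [p 0] as long as the chain of the [E j] lasts. *)
Section Growth.
Local Open Scope ring_scope.
Variables (F : fieldType) (V : lmodType F).
Variables (g h : gl V) (y : {linear V -> V}).
Hypotheses (hE : forall v, h v = v + y v).
Hypotheses (hVE : forall v, (h^-1)%g v = v - y v).
Variables (n : nat) (E : nat -> set V) (phi : nat -> {scalar V}) (p : nat -> V).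
Hypotheses (sE : forall j, is_subspace (E j)).
Hypotheses (gE : forall j v, E j v -> E j (g v)).
Hypotheses (EE : forall j, E j `<=` E j.+1).
Hypotheses (Ep : forall j, (j <= n)%N -> E j (p j)).
Hypotheses (phigp : forall j, (j <= n)%N -> phi j (g (p j)) = 1).
Hypotheses (phiE : forall j v, (j < n)%N -> E j v -> phi j.+1 v = 0).
Hypotheses (yE : forall j v, (j < n)%N -> E j v ->
  E j (y v - phi j v *: p j.+1)).

Lemma growth_step j (s : F) z : (j < n)%N -> s != 0 ->
  E j z -> phi j (g z) != 0 ->
  E j.+1 (g z + s *: y (g z)) /\ phi j.+1 (g (g z + s *: y (g z))) != 0.
Proof.
move=> jn s0 Ez phiz; set c := phi j (g z) in phiz.
have Egz := gE Ez; set e := y (g z) - c *: p j.+1.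
have Ee : E j e by apply: yE.
have -> : y (g z) = e + c *: p j.+1 by rewrite subrK.
clearbody e c; split.
  apply: subspaceD; [exact: sE | exact: EE|].
  apply: subspaceZ; first exact: sE.
  apply: subspaceD; [exact: sE | exact: EE|].
  by apply: subspaceZ; [exact: sE | exact: Ep].
rewrite !(linearD, linearZ) /= phigp// mulr1.
rewrite (phiE jn (gE Egz)) (phiE jn (gE Ee)) !add0r.
by rewrite mulf_neq0.
Qed.

Lemma growth m : (m.*2 <= n)%N ->
  E m.*2 (iter m (gl_sub1 (g * g ^ h)%g) (p 0%N)) /\
  phi m.*2 (g (iter m (gl_sub1 (g * g ^ h)%g) (p 0%N))) != 0.
Proof.
elim: m => [_|m IHm]; first by rewrite /= phigp// oner_eq0; split=> //; apply: Ep.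
rewrite doubleS => mn; rewrite iterS.
have [Ez phiz] := IHm (ltnW (ltnW mn)); set z := iter _ _ _ in Ez phiz *.
set j := m.*2 in mn Ez phiz *.
have N1 : (-1 : F) != 0 by rewrite oppr_eq0 oner_eq0.
have [Ez1 phiz1] := growth_step (ltnW mn) N1 Ez phiz.
set z1 := _ + _ in Ez1 phiz1.
have [Ez2 phiz2] := growth_step mn (oner_neq0 F) Ez1 phiz1.
set z2 := _ + _ in Ez2 phiz2.
have -> : gl_sub1 (g * g ^ h)%g z = z2 - z.
  have -> : z2 = h (g ((h^-1)%g (g z))).
    by rewrite hVE hE /z2 /z1 scale1r scaleN1r.
  by [].
split; first by apply: subspaceB => //; do 2 apply: EE.
rewrite !linearB /= (phiE mn (v := g z)) ?subr0//.
by apply: gE; apply: EE.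
Qed.

End Growth.

(** * Elements of locally nilpotent normal subgroups *)

Lemma state_choice (T : Type) (I : T -> Prop) (R : nat -> T -> T -> Prop) t0 :
  I t0 -> (forall n t, I t -> exists t', I t' /\ R n t t') ->
  exists f : nat -> T, f 0%N = t0 /\ forall n, R n (f n) (f n.+1).
Proof.
move=> It0 step.
have /choice[next nextP] : forall nt : nat * {t | I t},
    exists t' : {t | I t}, R nt.1 (sval nt.2) (sval t').
  by move=> [n [t It]]; have [t' [It' Rt]] := step n t It; exists (exist _ t' It').
pose fix f n := if n is k.+1 then next (k, f k) else exist _ t0 It0.
by exists (fun n => sval (f n)); split=> // n; apply: (nextP (n, f n)).
Qed.

Section LocallyNilpotentFinite.
Local Open Scope ring_scope.
Variables (F : fieldType) (V : lmodType F) (L : set (set V)).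
Hypothesis serL : subspace_series L.
Implicit Types (B T U W X E Y : set V) (u v w : V).

Lemma countable_dim_sequence : countable_dim V ->
  exists e : nat -> V, forall W, is_subspace W -> (forall n, W (e n)) ->
  forall v, W v.
Proof.
case=> B [_ spanB] /countable_injP[f injf].
have /choice[e eP] : forall n, exists v, forall b, B b -> f b = n -> v = b.
  move=> n; have [[b [Bb fb]]|nob] := pselect (exists b, B b /\ f b = n).
    exists b => b' Bb' fb'; apply: injf; rewrite ?inE//.
    by rewrite fb fb'.
  by exists 0 => b Bb fb; case: nob; exists b.
exists e => W sW We v; have : smallest (@is_subspace F V) B v by rewrite spanB.
apply; split=> // b Bb; rewrite -(eP (f b) b) //.
Qed.

Variables (N : set (gl V)) (g : gl V).
Hypotheses (nN : normal_subgroup N (stability_group L)).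
Hypotheses (lnN : locally_nilpotent N) (Ng : N g).

Let Sg : stability_group L g. Proof. by case: nN => _ + _; apply. Qed.

Let sub_g (h : gl V) : stability_group L h -> N (g * g ^ h)%g.
Proof.
by case: nN => sN _ conjN Sh; apply: subgroupM => //; apply: conjN.
Qed.

Local Notation x := (gl_sub1 g).

(** ** No member is stuck *)

(** If no member above [U] is moved into [U], the members above [U] descend to
    [U]. Countable dimension allows choosing decreasing members [X j] and an
    exhausting sequence of subspaces [E j] that meet [X j] inside [U]; with
    [v j] in [X j] and functionals [phi j] killing [E j], [X j.+1] and [v j]
    but with [phi j (x (v j)) = 1], the sum of the transvections
    [phi j (.) *: v j.+1] is an [h] for which the orbit of [v 0] grows for
    ever, against [engel_vector]. *)
Section Descending.
Hypothesis dimV : countable_dim V.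
Variable U : set V.
Hypotheses (LU : L U) (UT : U <> setT).
Hypothesis stuck : forall W, L W -> U `<` W -> exists2 v, W v & ~ U (x v).

Let sU : is_subspace U. Proof. exact: (series_subspace serL). Qed.

(** If every member above [U] contained [t], the least of them would form a
    jump with [U], and [g] would move it into [U]. *)
Let avoid W t : L W -> U `<` W -> ~ U t ->
  exists W', [/\ L W', U `<` W', W' `<=` W & ~ W' t].
Proof.
move=> LW UW nUt.
suff [W' [LW' UW' nW't]] : exists W', [/\ L W', U `<` W' & ~ W' t].
  by have [W'W|WW'] := series_total serL LW' LW; [exists W' | exists W; split=> // /WW'].
apply: contrapT => noW; pose TT := [set W | L W /\ U `<` W].
have allt A : TT A -> A t.
  by move=> [LA UA]; apply: contrapT => nAt; apply: noW; exists A.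
have LT : L (\bigcap_(A in TT) A) by apply: (series_cap serL) => A [].
have UTT : U `<` \bigcap_(A in TT) A.
  split=> [u Uu A [_ [UA _]]|TU]; first exact: UA.
  by apply: nUt; apply: TU => A; apply: allt.
have [v Tv nUv] := stuck LT UTT; apply: nUv.
move/stability_groupE: Sg => Sg'; apply: Sg' Tv; split=> // -[A [LA UA [_ nTA]]].
by apply: nTA => u; apply.
Qed.

(** What is needed of the finite dimensional subspaces [E j]: small members
    above [U] avoid them modulo [U]. *)
Let thin E := is_subspace E /\ forall W, L W -> U `<` W ->
  exists W', [/\ L W', U `<` W', W' `<=` W & forall v, W' v -> E v -> U v].

Let thin_add E e : thin E -> exists E', [/\ thin E', E `<=` E' & E' e].
Proof.
move=> [sE tE]; pose E' : set V := [set u | exists c, E (u - c *: e)].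
have EE' : E `<=` E' by move=> u Eu; exists 0; rewrite scale0r subr0.
have sE' : is_subspace E' by exact: subspace_add_line.
exists E'; split=> //; last by exists 1; rewrite scale1r subrr; apply: subspace0.
split=> // W LW UW; have [W1 [LW1 UW1 W1W W1E]] := tE W LW UW.
have sW1 := series_subspace serL LW1.
have [[t [W1t E't nUt]]|noT] := pselect (exists t, [/\ W1 t, E' t & ~ U t]); last first.
  exists W1; split=> // v W1v E'v; apply: contrapT => nUv.
  by apply: noT; exists v.
have [W2 [LW2 UW2 W21 nW2t]] := avoid LW1 UW1 nUt.
exists W2; split=> //; first exact: subset_trans W1W.
move=> v W2v [cv Ev]; have sW2 := series_subspace serL LW2.
have [ct Et] := E't.
have [ct0|ct0] := eqVneq ct 0.
  by case: nUt; apply: W1E => //; rewrite ct0 scale0r subr0 in Et.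
pose c := cv / ct.
have Uvt : U (v - c *: t).
  apply: W1E; first by apply: subspaceB => //; [exact: W21 | exact: subspaceZ].
  have -> : v - c *: t = (v - cv *: e) - c *: (t - ct *: e).
    by rewrite scalerBr scalerA /c divfK// opprB addrA subrK.
  by apply: subspaceB => //; apply: subspaceZ.
have [c0|c0] := eqVneq c 0; first by move: Uvt; rewrite c0 scale0r subr0.
case: nW2t; apply: (subspaceZr sW2 c0); apply: (subspaceBr sW2 W2v).
by case: UW2 => + _; apply.
Qed.

Let thin_adds E (f : nat -> V) n : thin E ->
  exists E', [/\ thin E', E `<=` E' & forall i, (i < n)%N -> E' (f i)].
Proof.
move=> tE; elim: n => [|n [E1 [tE1 EE1 E1f]]]; first by exists E; split.
have [E2 [tE2 E12 E2f]] := thin_add (f n) tE1.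
exists E2; split=> //; first exact: subset_trans E12.
move=> i; rewrite ltnS leq_eqVlt => /orP[/eqP->//|/E1f]; exact: E12.
Qed.

(** One step of the construction, for a state consisting of [E j] and [X j];
    [e] runs through a spanning sequence. *)
Let next (e : V) (s s' : set V * set V) :=
  [/\ s.1 `<=` s'.1, s'.2 `<=` s.2, s'.1 e, L s'.2 &
    exists v (phi : {scalar V}),
    [/\ s.2 v, (forall u, s.1 u -> phi u = 0) /\ (forall u, s'.2 u -> phi u = 0),
      phi v = 0, phi (x v) = 1 & forall n, s'.1 (iter n x v)]].

Lemma no_stuck_member : False.
Proof.
have [e espan] := countable_dim_sequence dimV.
have [t nUt] : exists t, ~ U t.
  by apply/existsNP => allU; apply: UT; apply/seteqP; split.
have UTT : U `<` setT by split=> // TU; apply: nUt; apply: TU.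
have [P [LP UP _ nPt]] := avoid (seriesT serL) UTT nUt.
have PT : P <> setT by move=> PT; apply: nPt; rewrite PT.
pose I (s : set V * set V) := [/\ thin s.1, L s.2, U `<` s.2, s.2 `<=` P
  & forall v, s.2 v -> s.1 v -> U v].
have [||f [f0 fR]] := @state_choice _ I (fun j => next (e j)) ([set 0], P).
- split=> //=; last by move=> v _ ->; apply: subspace0.
  split=> [|W LW UW]; first exact: subspace_set0.
  by exists W; split=> // v _ ->; apply: subspace0.
- move=> j [E X] [/= tE LX UX XP XE]; have [v Xv nUx] := stuck LX UX.
  have [m vm] := engel_vector serL nN lnN Ng LP PT (XP _ Xv).
  have [E1 [tE1 EE1 E1e]] := thin_add (e j) tE.
  have [E2 [tE2 E12 E2v]] := thin_adds (fun i => iter i x v) m tE1.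
  have E2x n : E2 (iter n x v).
    have [nm|mn] := ltnP n m; first exact: E2v.
    rewrite -(subnK mn) iterD vm.
    elim: (n - m)%N => [|k /= IHk]; first by apply: subspace0; case: tE2.
    have -> : iter k x 0 = 0 :> V by elim: k {IHk} => //= k ->; rewrite linear0.
    by rewrite linear0; apply: subspace0; case: tE2.
  have [X2 [LX2 UX2 X2X X2E]] := tE2.2 X LX UX.
  have [sE sX sX2] := And3 tE.1 (series_subspace serL LX) (series_subspace serL LX2).
  have sE2 := tE2.1.
  have [c w X2w Eu|phi [phiX2 phiE phivv phix]] :=
      separation_sum (v := v) (t := x v) sX2 sE.
    set u := _ - w in Eu.
    have Xx : X (x v) by exact: (stability_sub1 serL Sg LX Xv).
    have Uw : U w.
      apply: X2E => //; have -> : w = x v - c *: v - u by rewrite /u subKr.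
      apply: subspaceB => //; last by apply: E12; apply: EE1.
      apply: subspaceB => //; first exact: (E2x 1%N).
      by apply: subspaceZ => //; exact: (E2x 0%N).
    have Uu : U u.
      apply: XE => //; rewrite /u; apply: subspaceB => //; last exact: X2X.
      by apply: subspaceB => //; apply: subspaceZ.
    have Uxc : U (x v - c *: v) by rewrite -(subrK w (_ - _)); apply: subspaceD.
    have nUv : ~ U v by move=> Uv; apply: nUx; apply: (stability_sub1 serL Sg LU Uv).
    have c0 := stability_no_eigenvalue serL Sg LU nUv Uxc.
    by apply: nUx; move: Uxc; rewrite c0 scale0r subr0.
  exists (E2, X2); split.
    by split=> //; apply: subset_trans XP.
  split=> //=; first exact: subset_trans E12.
    exact: E12.
  by exists v, phi.
pose E j := (f j).1; pose X j := (f j).2.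
have /choice[v /choice[phi vP]] : forall j, exists v (phi : {scalar V}),
    [/\ X j v, (forall u, E j u -> phi u = 0) /\ (forall u, X j.+1 u -> phi u = 0),
      phi v = 0, phi (x v) = 1 & forall n, E j.+1 (iter n x v)].
  by move=> j; case: (fR j).
have monoE i j : (i <= j)%N -> E i `<=` E j.
  move=> /subnKC <-; elim: (j - i)%N => [|k IHk]; first by rewrite addn0.
  rewrite addnS; apply: subset_trans IHk _.
  by have [] := fR (i + k)%N.
have monoX i j : (i <= j)%N -> X j `<=` X i.
  move=> /subnKC <-; elim: (j - i)%N => [|k IHk]; first by rewrite addn0.
  rewrite addnS => u Xu; apply: IHk.
  by have [_ XX _ _ _] := fR (i + k)%N; apply: XX.
have phiv i j n : (j < i)%N -> phi i (iter n x (v j)) = 0.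
  move=> ji; have [_ [phiE _] _ _ _] := vP i; have [_ _ _ _ vE] := vP j.
  by apply: phiE; exact: (monoE _ _ ji).
(* This makes the sum of the transvections square to zero. *)
have phiv0 i j : phi i (v j) = 0.
  have [_ [_ phiX] phivi _ _] := vP i; have [Xv _ _ _ _] := vP j.
  have [ij|ji|<-//] := ltngtP i j; last exact: (phiv i j 0%N).
  by apply: phiX; exact: (monoX _ _ ij).
have fin u : exists n, forall j, (n <= j)%N -> phi j u = 0.
  apply: (espan [set u | exists n, forall j, (n <= j)%N -> phi j u = 0]).
    apply: subspaceP => [|c u1 u2 [n1 un1] [n2 un2]].
      by exists 0%N => j _; rewrite linear0.
    exists (maxn n1 n2) => j; rewrite geq_max => /andP[n1j n2j].
    by rewrite linearP un1 ?un2// mulr0 addr0.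
  move=> n; exists n.+1 => j nj; have [_ [phiE _] _ _ _] := vP j.
  by apply: phiE; apply: (monoE n.+1) => //; have [_ _ + _ _] := fR n; apply.
have [|i j|y [h [yE Sh hE hVE]]] :=
    stable_transvections serL (phi := phi) (p := fun j => v j.+1) (Z := fun j => X j.+1) _ _ fin.
- move=> i; have [_ [_ phiX] _ _ _] := vP i; split=> //.
    by have [] := fR i.
  by have [] := vP i.+1.
- exact: phiv0.
pose A j := killed phi g [pred i | (j < i)%N].
have sA j : is_subspace (A j) by exact: killed_subspace.
have gA j z : A j z -> A j (g z) by exact: killed_stable.
have Av j : A j (v j) by move=> i n; apply: phiv.
have monoA i j : (i <= j)%N -> A i `<=` A j.
  by move=> ij; apply: sub_killed => k; apply: leq_ltn_trans.
have AA j : A j `<=` A j.+1 by exact: monoA.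
have [|m vm] := engel_vector serL nN lnN (sub_g Sh) LP PT (w := v 0%N).
  by have [] := vP 0%N; rewrite /X f0.
have [||||//] := growth hE hVE (n := m.*2) sA gA AA (phi := phi) (p := v) _ _ _ _ (leqnn _).
- by [].
- by move=> j _; rewrite gl_sub1E linearD /=; have [_ _ -> -> _] := vP j; rewrite addr0.
- by move=> j u _; apply: killed_phi => /=.
- move=> j u _ Au; rewrite (yE u j.+1); last by move=> i ji; apply: (killed_phi _ Au).
  rewrite big_ord_recr /= addrK; apply: (subspace_sum (sA j)) => i _.
  exact: (subspaceZ _ (sA j) (monoA _ _ (ltn_ord i) _ (Av _))).
by move=> _; rewrite vm linear0 linear0 eqxx.
Qed.

End Descending.

(** ** No endless ascent *)

(** The mirror image of the descending case: subspaces of finite codimension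
    replace those of finite dimension, and the transvections
    [phi j.+1 (.) *: v j] move downwards, so that growth from [v n] with
    indices counted backwards ends at the fixed functional [phi 0], against
    [engel_functional]. *)
Section Ascending.
Variable U : nat -> set V.
Hypotheses (LU : forall k, L (U k)) (U0 : U 0%N = [set 0]).
Hypothesis Umax : forall k W, L W -> (forall v, W v -> U k (x v)) -> W `<=` U k.+1.
Hypothesis Ustrict : forall k, U k `<` U k.+1.

Let Q : set V := \bigcup_k U k.

Let sU k : is_subspace (U k). Proof. exact: (series_subspace serL). Qed.

Let U_le i j : (i <= j)%N -> U i `<=` U j.
Proof.
move=> /subnKC <-; elim: (j - i)%N => [|k IHk]; first by rewrite addn0.
by rewrite addnS => u /IHk; apply: (Ustrict _).1.
Qed.

Let LQ : L Q.
Proof. exact: series_bigcup. Qed.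

(** What is needed of the subspaces of finite codimension: [x] does not send
    the part inside [Q] into a single [U k]. *)
Let ample Y :=
  is_subspace Y /\ forall k, exists v, [/\ Y v, Q v & ~ U k (x v)].

Let ampleT : ample setT.
Proof.
split=> [|k]; first exact: (series_subspace serL (seriesT serL)).
apply: contrapT => noV; have [_] := Ustrict k.+1; apply.
apply: Umax => // v Uv; apply: contrapT => nUv; apply: noV.
by exists v; split=> //; exists k.+2.
Qed.

Let ample_ker Y (phi : {scalar V}) :
  ample Y -> ample [set v | Y v /\ phi v = 0].
Proof.
move=> [sY aY]; split=> [|k].
  apply: subspaceP => [|c u w [Yu pu] [Yw pw]].
    by split; [exact: subspace0 | rewrite linear0].
  by split; [exact: subspaceZD | rewrite linearP pu pw mulr0 addr0].
have [v1 [Yv1 [l _ Uv1] nv1]] := aY k.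
have Qv1 : Q v1 by exists l.
have [p1|p1] := eqVneq (phi v1) 0; first by exists v1.
have [v2 [Yv2 Qv2 nv2]] := aY (k + l)%N.
have sQ := series_subspace serL LQ.
(* The second vector dominates the first, as [x v1] lies in [U (k + l)]. *)
exists (phi v2 *: v1 - phi v1 *: v2); split.
- split; first by apply: subspaceB => //; apply: subspaceZ.
  by rewrite linearB !linearZ /= mulrC subrr.
- by apply: subspaceB => //; apply: subspaceZ.
have -> : x (phi v2 *: v1 - phi v1 *: v2) = phi v2 *: x v1 - phi v1 *: x v2.
  by rewrite linearB; congr (_ - _); rewrite linearZ.
move=> /(U_le (leq_addr l k)) Uv; apply: nv2.
apply: (subspaceZr (sU _) p1). apply: (subspaceBr (sU _) _ Uv).
apply: subspaceZ => //; apply: (stability_sub1 serL Sg (LU _)).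
exact: U_le (leq_addl k l) _ Uv1.
Qed.

Let ample_kers Y (psi : nat -> {scalar V}) n :
  ample Y -> ample [set v | Y v /\ forall i, (i < n)%N -> psi i v = 0].
Proof.
move=> aY; elim: n => [|n IHn].
  have -> : [set v | Y v /\ forall i, (i < 0)%N -> psi i v = 0] = Y => //.
  by apply/seteqP; split=> [v []//|v Yv].
have -> : [set v | Y v /\ forall i, (i < n.+1)%N -> psi i v = 0] =
    [set v | [set v | Y v /\ forall i, (i < n)%N -> psi i v = 0] v /\ psi n v = 0].
  apply/seteqP; split=> v.
    by move=> [Yv pv]; split; [split=> // i /ltnW; apply: pv | exact: pv].
  by move=> [[Yv pv] pn]; split=> // i; rewrite ltnS leq_eqVlt => /orP[/eqP->//|/pv].
exact: ample_ker.
Qed.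

(** The functionals are made to vanish on a complement [D] of [Q]; otherwise
    the sum of transvections would only be locally finite on [Q]. *)
Variable D : set V.
Hypotheses (sD : is_subspace D) (QD : forall v, Q v -> D v -> v = 0).
Hypothesis decQD : forall v, exists2 w, Q w & D (v - w).

(** One step of the construction, for a state consisting of the index of a
    member [U k] and an ample subspace [Y]. *)
Let next (s s' : nat * set V) :=
  [/\ (s.1 < s'.1)%N, s'.2 `<=` s.2 & exists v (phi : {scalar V}),
    [/\ U s'.1 v /\ s.2 v,
      (forall u, U s.1 u -> phi u = 0) /\ (forall u, D u -> phi u = 0),
      phi v = 0, phi (x v) = 1
    & forall u, s'.2 u -> forall n, phi (iter n x u) = 0]].

Lemma no_ascending_members : False.
Proof.
have U1T : U 1%N <> setT by move=> U1T; have [_] := Ustrict 1; apply; rewrite U1T.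
have U10 : U 1%N <> [set 0] by rewrite -U0 => U10; have [_] := Ustrict 0; apply; rewrite U10.
pose I (s : nat * set V) := ample s.2 /\ (0 < s.1)%N.
have [//||f [f0 fR]] := @state_choice _ I (fun=> next) (1%N, setT).
  move=> _ [k Y] [/= aY k0]; have [v [Yv Qv nUx]] := aY.2 k.
  have [l _ Uv] := Qv; pose k' := maxn l k.+1.
  have sQ := series_subspace serL LQ.
  have [c d Dd Ud|phi [phiD phiU phivv phix]] :=
      separation_sum (v := v) (t := x v) sD (sU k).
    have Qxv : Q (x v - c *: v).
      apply: subspaceB => //; last exact: subspaceZ.
      exact: (stability_sub1 serL Sg LQ Qv).
    have d0 : d = 0.
      by apply: QD => //; apply: (subspaceBr sQ Qxv); exists k.
    have nUv : ~ U k v.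
      by move=> Uv'; apply: nUx; apply: (stability_sub1 serL Sg (LU k) Uv').
    rewrite d0 subr0 in Ud.
    have c0 := stability_no_eigenvalue serL Sg (LU k) nUv Ud.
    by apply: nUx; rewrite c0 scale0r subr0 in Ud.
  have [u U1u|m phim] := engel_functional serL nN lnN Ng (LU 1) (phi := phi) U1T U10.
    by apply/phiU/(U_le k0).
  have /choice[psi psiE] : forall i, exists psi : {scalar V}, psi =1 (fun u => phi (iter i x u)).
    by move=> i; apply: scalar_of => c u w; rewrite iter_linear linearP.
  exists (k', [set u | Y u /\ forall i, (i < m)%N -> psi i u = 0]).
  split; first by split; [exact: ample_kers | rewrite /= leq_max orbT].
  split=> [|u []//|]; first by rewrite /= leq_max leqnn orbT.
  exists v, phi; split=> //; first by split=> //; apply: U_le Uv; exact: leq_maxl.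
  move=> u [_ pu] n; have [nm|mn] := ltnP n m; first by rewrite -psiE pu.
  by rewrite -(subnKC mn) iterD phim.
pose k j := (f j).1; pose Y j := (f j).2.
have /choice[v /choice[phi vP]] : forall j, exists v (phi : {scalar V}),
    [/\ U (k j.+1) v /\ Y j v,
      (forall u, U (k j) u -> phi u = 0) /\ (forall u, D u -> phi u = 0),
      phi v = 0, phi (x v) = 1
    & forall u, Y j.+1 u -> forall n, phi (iter n x u) = 0].
  by move=> j; case: (fR j).
have kS j : (k j < k j.+1)%N by have [] := fR j.
have k_le i j : (i <= j)%N -> (k i <= k j)%N.
  move=> /subnKC <-; elim: (j - i)%N => [|l IHl]; first by rewrite addn0.
  by rewrite addnS; apply: leq_trans IHl (ltnW (kS _)).
have k_ge j : (j <= k j)%N.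
  by elim: j => // j IHj; apply: leq_ltn_trans IHj (kS j).
have monoY i j : (i <= j)%N -> Y j `<=` Y i.
  move=> /subnKC <-; elim: (j - i)%N => [|l IHl]; first by rewrite addn0.
  by rewrite addnS => u Yu; apply: IHl; have [_ YY _] := fR (i + l)%N; apply: YY.
have phiv i j n : (i < j)%N -> phi i (iter n x (v j)) = 0.
  move=> ij; have [_ _ _ _ phiY] := vP i; have [[_ Yv] _ _ _ _] := vP j.
  by apply: phiY; exact: (monoY _ _ ij).
have phiU i u : U (k i) u -> phi i u = 0 by have [_ [+ _] _ _ _] := vP i; apply.
have phiv0 i j : phi i (v j) = 0.
  have [_ _ phivi _ _] := vP i; have [[Uv _] _ _ _ _] := vP j.
  have [ij|ji|<-//] := ltngtP i j; first exact: (phiv i j 0%N).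
  by apply: phiU; apply: U_le Uv; apply: k_le.
have fin u : exists n, forall j, (n <= j)%N -> phi j u = 0.
  have [w [l _ Uw] Dw] := decQD u; exists l => j lj.
  rewrite -(subrK w u) linearD /=; have [_ [_ phiD] _ _ _] := vP j.
  rewrite phiD// add0r; apply: phiU; apply: U_le Uw.
  exact: leq_trans (k_ge j).
(* The functional [phi 0] takes part without a vector to be directed to. *)
pose q j := if j is i.+1 then v i else 0.
have [|i j|y [h [yE Sh hE hVE]]] :=
    stable_transvections serL (phi := phi) (p := q) (Z := fun j => U (k j)) _ _ fin.
- move=> i; split=> //; last exact: phiU.
  by case: i => [|i] /=; [exact: subspace0 | have [[]] := vP i].
- by case: j => [|j] /=; [rewrite linear0 | exact: phiv0].
have [phig phigE] := scalar_of (f := fun u => phi 0%N (g u))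
  (fun c u w => etrans (congr1 _ (linearP _ _ _ _)) (linearP _ _ _ _)).
have [u U1u|m vm] := engel_functional serL nN lnN (sub_g Sh) (LU 1) (phi := phig) U1T U10.
  rewrite phigE; apply: phiU; rewrite /k f0 /=.
  exact: (stability_stable serL Sg (LU 1)).
pose n := m.*2.
pose A j := killed phi g [pred i | (i < n - j)%N].
have sA j : is_subspace (A j) by exact: killed_subspace.
have gA j z : A j z -> A j (g z) by exact: killed_stable.
have AA j : A j `<=` A j.+1.
  by apply: sub_killed => i /= ij; apply: leq_trans ij _; rewrite leq_sub2l.
have Av j i : (n - j <= i)%N -> A j (v i).
  by move=> ji i' l i'j; apply: phiv; apply: leq_trans ji.
have [||||//] := growth hE hVE (n := n) sA gA AA
  (phi := fun j => phi (n - j)%N) (p := fun j => v (n - j)%N) _ _ _ _ (m := m) (leqnn _).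
- by move=> j _; apply: Av.
- move=> j _; rewrite gl_sub1E linearD /=.
  by have [_ _ -> -> _] := vP (n - j)%N; rewrite addr0.
- by move=> j u jn; apply: killed_phi => /=; rewrite subnSK.
- move=> j u jn Au; have [l ul] := fin u.
  pose r := (n - j)%N; have r0 : (0 < r)%N by rewrite subn_gt0.
  have rl : (r < l + r.+1)%N by rewrite addnS ltnS leq_addl.
  rewrite (yE u (l + r.+1)%N); last first.
    by move=> i li; apply: ul; apply: leq_trans li; apply: leq_addr.
  have qr : q r = v (n - j.+1)%N by rewrite subnS -/r -(prednK r0).
  rewrite (bigD1 (Ordinal rl)) //= qr addrAC subrr add0r.
  apply: (subspace_sum (sA j)) => i ir.
  have [ri|ir'|ri] := ltngtP (i : nat) r.
  + by rewrite (killed_phi _ Au)// scale0r; apply: subspace0.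
  + apply: (subspaceZ _ (sA j)); move: ir'; case: (i : nat) => //= i' ri'.
    exact: Av.
  + by case/eqP: ir; apply: val_inj.
by rewrite subnn -phigE vm eqxx.
Qed.

End Ascending.

(** The greedy series [U 0 = 0], with [U k.+1] the largest member [W] such
    that [W (g - 1)] lies in [U k]: it is finite unless it gets stuck below
    the whole space or ascends for ever. *)
Lemma locally_nilpotent_finite_stabilizer : countable_dim V ->
  finite_stabilizer L g.
Proof.
move=> dimV.
pose up W : set V := \bigcup_(T in [set T | L T /\ forall v, T v -> W (x v)]) T.
pose U := fix U k := if k is i.+1 then up (U i) else [set 0] : set V.
have LU k : L (U k).
  elim: k => [|k LUk] /=; first exact: series0 serL.
  apply: (series_cup serL) => [T []//|]; exists [set 0]; split.
    exact: series0 serL.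
  by move=> _ ->; rewrite linear0; apply: (series_mem0 serL).
have Ux k v : U k.+1 v -> U k (x v) by move=> [T [_ TU] Tv]; apply: TU.
have Umax k W : L W -> (forall v, W v -> U k (x v)) -> W `<=` U k.+1.
  by move=> LW WU v Wv; exists W.
have USub k : U k `<=` U k.+1.
  by apply: Umax => // v; apply: (stability_sub1 serL Sg (LU k)).
have [[n UnT]|nT] := pselect (exists n, U n = setT); last first.
  exfalso; have [strict|] := pselect (forall k, U k `<` U k.+1).
    have LQ : L (\bigcup_k U k) by exact: series_bigcup.
    have [v _ ->//|D [sD _ QD decQD]] :=
      complement (series_subspace serL LQ) (@subspace_set0 F V).
    exact: (@no_ascending_members U LU erefl Umax strict D sD QD decQD).
  move=> /existsNP[k nstrict].
  have UkS : U k.+1 `<=` U k.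
    by apply: contrapT => nS; apply: nstrict; split.
  apply: (@no_stuck_member dimV (U k)) => // [UT|W LW [UW nWU]].
    by apply: nT; exists k.
  apply: contrapT => noV; apply: nWU; apply: subset_trans UkS.
  apply: Umax => // v Wv; apply: contrapT => nUv; apply: noV.
  by exists v.
have finM : finite_set (U @` `I_n.+1) by apply: finite_image; exact: finite_II.
have sM : subseries (U @` `I_n.+1) L.
  apply: finite_subseries => //; first by move=> _ [k _ <-].
    by exists 0%N.
  by exists n => //=.
exists (U @` `I_n.+1); split=> //; apply/stability_groupE.
move=> B T v [[b _ <-] [t tn tT] [BT nTB] noW] Tv.
have ext : exists t, `[< U t = T >] by exists t; apply/asboolP.
case: (ex_minnP ext) => t0 /asboolP t0T tmin.
have := tmin t; rewrite asboolE => /(_ tT) t0t.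
case: t0 t0T tmin t0t => [t0T _ _|i iT tmin it].
  by exfalso; apply: nTB; rewrite -t0T => _ ->; apply: (series_mem0 serL (LU b)).
have UiB : U i `<=` U b.
  have [//|BUi] := series_total serL (LU i) (LU b).
  apply: contrapT => nUiB; apply: noW; exists (U i); split.
  - by exists i => //=; exact: leq_trans it (ltnW tn).
  - by split.
  - split; first by rewrite -iT; apply: USub.
    move=> TU; suff: (i < i)%N by rewrite ltnn.
    apply: tmin; apply/asboolP.
    by apply/seteqP; split=> // u Uu; rewrite -iT; exact: USub.
by apply: UiB; apply: Ux; rewrite iT.
Qed.

End LocallyNilpotentFinite.

(** * The Hirsch-Plotkin radical *)

Theorem theoremA (F : fieldType) (V : lmodType F) (L : set (set V))
    (dimV : countable_dim V) (serL : subspace_series L) :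
  hirsch_plotkin (stability_group L) =
    [set g | stability_group L g /\
       exists M : set (set V),
         [/\ subseries M L, finite_set M & stability_group M g]] /\
  fitting_group (hirsch_plotkin (stability_group L)).
Proof.
have HP : hirsch_plotkin (stability_group L) = finite_stabilizer L.
  apply/seteqP; split.
    apply: generated_min; first exact: finite_stabilizer_subgroup.
    move=> g [N [nN lnN] Ng].
    exact: (locally_nilpotent_finite_stabilizer serL nN lnN Ng dimV).
  move=> g [M [sM finM Sg]]; apply: sub_generated.
  exists (stability_group M) => //; split; first exact: stability_group_normal.
  apply: nilpotent_locally_nilpotent; apply: stability_group_nilpotent => //.
  by case: sM.
rewrite HP; split.
  apply/seteqP; split=> g; last by case.
  by move=> Kg; split=> //; apply: finite_stabilizer_stability Kg.
have sK := finite_stabilizer_subgroup serL; split=> //.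
apply/seteqP; split.
  by apply: generated_min => // g [N [[_ NK _] _]]; apply: NK.
move=> g [M [sM finM Sg]]; apply: sub_generated.
have [sS _ conjS] := stability_group_normal serL sM.
exists (stability_group M) => //; split; last first.
  by apply: stability_group_nilpotent => //; case: sM.
split=> // [h Sh|h k Sh Kk]; first by exists M.
by apply: conjS => //; apply: finite_stabilizer_stability Kk.
Qed.
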